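(* Let $n\ge 1$, $a_0>0$, $a_1>0$ and $\sigma>-1+2/n$ (so that $T_0<0$ and $T_1=\infty$). Let $\lambda\in\mathbb{R}$ and $1<p<\infty$, and let $f(Y)=\lambda|Y|^{p-1}Y$ or $f(Y)=\lambda|Y|^p$. Let $q_*$ be an arbitrary number with $1\le q_*\le\infty$ and $1-p/2\le 1/q_*$. For $Y_0,Y_1\in\mathbb{R}^n$ put $D:=\sqrt{A(0)}\,|Y_0|+|Y_1|$. Consider the Cauchy problem $$D_t^2Y(t)+A(t)Y(t)+f(Y)(t)=0,\qquad Y(0)=Y_0,\quad D_tY(0)=Y_1. \qquad (\mathrm{CP})$$ (1) For any $Y_0,Y_1\in\mathbb{R}^n$ there exist $T>0$ and $R>0$ such that (CP) has a unique solution $Y\in X(T,R)$. Here $T>0$ can be taken to be any positive real number satisfying $$T\le\begin{cases}-T_0\left\{\left(1-\dfrac{C}{T_0D^{(p-1)q_*}}\right)^{1/((p+1)q_* )}-1\right\}&\text{if } q_*<\infty,\ 0\le D<\infty,\\[2mm] -T_0\left(\dfrac{C}{D^{(p-1)/(p+1)}}-1\right)&\text{if } q_*=\infty,\ D<C^{(p+1)/(p-1)},\end{cases}$$ for some constant $C>0$ which is independent of $Y_0$ and $Y_1$ (when $D=0$ the right-hand side is read as $+\infty$). (2) The solution $Y$ in (1) satisfies $Y\in C^1([0,T))$. (3) The solution $Y$ in (1) is unique in $C^1([0,T))\cap X(T)$. (4) If $\lambda\ge0$ and $f(Y)=\lambda|Y|^{p-1}Y$, then the solution $Y$ in (1) is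 a global solution; namely, $T$ can be taken as $T=T_1=\infty$.
   Context: $D_t:=d/dt$. For $n\ge1$, $a_0>0$, $a_1,\sigma\in\mathbb{R}$: if $\sigma\ne-1$ and $a_1\neq 0$ put $T_0:=-\frac{2a_0}{n(1+\sigma)a_1}$; put $T_1:=T_0$ if $(1+\sigma)a_1<0$ and $T_1:=\infty$ if $(1+\sigma)a_1\ge0$. The scale-function is, for $0\le t<T_1$, $a(t):=a_0\left(1+\frac{n(1+\sigma)a_1t}{2a_0}\right)^{2/(n(1+\sigma))}$ if $\sigma\neq-1$ and $a(t):=a_0e^{a_1t/a_0}$ if $\sigma=-1$. Put $q_0(t):=\frac{D_t(a(t)^2)}{a(t)^2}$ and $A(t):=-\frac14q_0(t)^2-\frac12D_tq_0(t)$. Under the hypotheses of the theorem $A>0$ and $D_tA<0$ on $[0,\infty)$. $Y=(Y^1,\dots,Y^n)$ is $\mathbb{R}^n$-valued and $|Y|=\{\sum_{j=1}^n(Y^j)^2\}^{1/2}$. In the case $f(Y)=\lambda|Y|^p$ the equation is read componentwise, every component of $f(Y)$ being $\lambda|Y|^p$. For $T>0$, $R>0$: $\|Y\|_{X(T)}:=\|D_tY\|_{L^\infty((0,T))}+\|\sqrt{A}\,Y\|_{L^\infty((0,T))}+\|\sqrt{-D_tA}\,Y\|_{L^2((0,T))}$, $X(T):=\{Y:\|Y\|_{X(T)}<\infty\}$, $X(T,R):=\{Y:\|Y\|_{X(T)}\le R\}$. A solution of (CP) on $[0,T)$ means a fixed point of the integral operator $\Psi(Y)^j(t):=\rho_0(t)Y_0^j+\rho_1(t)Y_1^j-\int_0^t\rho_{12}(t,s)f(Y)^j(s)\,ds$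 ($1\le j\le n$), where $\rho_0,\rho_1$ solve $(D_t^2+A(t))\rho_i=0$ with $\rho_0(0)=1$, $D_t\rho_0(0)=0$, $\rho_1(0)=0$, $D_t\rho_1(0)=1$, and $\rho_{12}(t,s):=-\rho_0(t)\rho_1(s)+\rho_1(t)\rho_0(s)$. A global solution is one that exists on $[0,T_1)$. *)

(* Defs.v *)
From HB Require Import structures.
From mathcomp Require Import all_boot all_order all_algebra.
From mathcomp Require Import all_classical all_reals all_analysis.

Set Implicit Arguments.
Unset Strict Implicit.
Unset Printing Implicit Defensive.

Import Order.TTheory GRing.Theory Num.Theory.
Import numFieldNormedType.Exports.

Local Open Scope classical_set_scope.
Local Open Scope ring_scope.

(* The final time T is an extended real: T = +oo is needed for global
   solutions. *)
Definition Ico {R : realType} (T : \bar R) : set R :=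
  [set t | 0 <= t /\ (t%:E < T)%E].

Definition Ioo {R : realType} (T : \bar R) : set R :=
  [set t | 0 < t /\ (t%:E < T)%E].

(* g is the derivative of f on I, the difference quotients being taken inside I;
   hence one-sided at the end point 0 of Ico T. *)
Definition derivative_on {R : realType} (I : set R) (f g : R -> R) : Prop :=
  forall t, I t ->
    (f s - f t) / (s - t) @[s --> within (I `\ t) (nbhs t)] --> g t.

Definition timeT0 {R : realType} (n : nat) (a0 a1 sigma : R) : R :=
  - (2 * a0 / (n%:R * (1 + sigma) * a1)).

Definition timeT1 {R : realType} (n : nat) (a0 a1 sigma : R) : \bar R :=
  if (1 + sigma) * a1 < 0 then (timeT0 n a0 a1 sigma)%:E else +oo%E.

(* On [0, T1) the base of the power is positive; it stays positive on a
   neighbourhood of 0, so that the two-sided derivatives in [q0], [A] and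
   [derive1 A] are also meaningful at t = 0, where they agree with the one-sided
   ones. *)
Definition scale {R : realType} (n : nat) (a0 a1 sigma t : R) : R :=
  if sigma == - 1 then a0 * expR (a1 * t / a0)
  else a0 * (1 + n%:R * (1 + sigma) * a1 * t / (2 * a0))
              `^ (2 / (n%:R * (1 + sigma))).

Definition q0 {R : realType} (n : nat) (a0 a1 sigma t : R) : R :=
  derive1 (fun s => scale n a0 a1 sigma s ^+ 2) t / scale n a0 a1 sigma t ^+ 2.

Definition coefA {R : realType} (n : nat) (a0 a1 sigma t : R) : R :=
  - (1 / 4) * q0 n a0 a1 sigma t ^+ 2
  - (1 / 2) * derive1 (q0 n a0 a1 sigma) t.

(* The library's norm on 'rV_n is the maximum norm. *)
Definition enorm {R : realType} {n : nat} (y : 'rV[R]_n) : R :=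
  Num.sqrt (\sum_(j < n) y 0 j ^+ 2).

Definition f_gauge {R : realType} (n : nat) (lambda p : R) (y : 'rV[R]_n)
    : 'rV[R]_n :=
  (lambda * enorm y `^ (p - 1)) *: y.

Definition f_abs {R : realType} (n : nat) (lambda p : R) (y : 'rV[R]_n)
    : 'rV[R]_n :=
  const_mx (lambda * enorm y `^ p).

Definition Dt {R : realType} {n : nat} (Y : R -> 'rV[R]_n) (t : R) : 'rV[R]_n :=
  \row_(j < n) derive1 (fun s => Y s 0 j) t.

(* Y is the continuous representative of a function whose distributional
   derivative is locally integrable on [0, T), i.e. Y is locally absolutely
   continuous; this derivative is then a.e. equal to the classical [Dt Y]. *)
Definition weakly_derivable {R : realType} {n : nat} (T : \bar R)
    (Y : R -> 'rV[R]_n) : Prop :=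
  exists V : R -> 'rV[R]_n, forall (j : 'I_n) (t : R), Ico T t ->
    lebesgue_measure.-integrable `[0, t] (fun s => (V s 0 j)%:E) /\
    Y t 0 j = Y 0 0 j + \int[lebesgue_measure]_(s in `[0, t]) V s 0 j.

(* L^q((0, T)) norm, through the extension by 0 outside (0, T). *)
Definition normL {R : realType} (q : \bar R) (T : \bar R) (g : R -> R) : \bar R :=
  Lnorm lebesgue_measure q (EFin \o (g \_ (Ioo T))).

Definition normX {R : realType} {n : nat} (A : R -> R) (T : \bar R)
    (Y : R -> 'rV[R]_n) : \bar R :=
  (normL +oo T (fun t => enorm (Dt Y t))
   + normL +oo T (fun t => enorm (Num.sqrt (A t) *: Y t))
   + normL 2%:E T (fun t => enorm (Num.sqrt (- derive1 A t) *: Y t)))%E.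

Definition spaceX {R : realType} {n : nat} (A : R -> R) (T : \bar R)
    : set (R -> 'rV[R]_n) :=
  [set Y | weakly_derivable T Y /\ (normX A T Y < +oo)%E].

Definition ballX {R : realType} {n : nat} (A : R -> R) (T : \bar R) (r : R)
    : set (R -> 'rV[R]_n) :=
  [set Y | weakly_derivable T Y /\ (normX A T Y <= r%:E)%E].

Definition spaceC1 {R : realType} {n : nat} (T : \bar R)
    : set (R -> 'rV[R]_n) :=
  [set Y | forall j : 'I_n, exists g : R -> R,
     derivative_on (Ico T) (fun t => Y t 0 j) g /\
     {within Ico T, continuous g}].

Definition linear_sol {R : realType} (A : R -> R) (T : \bar R) (c0 c1 : R)
    (rho : R -> R) : Prop :=
  exists rho' rho'' : R -> R,
    [/\ derivative_on (Ico T) rho rho',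
        derivative_on (Ico T) rho' rho'',
        (forall t, Ico T t -> rho'' t + A t * rho t = 0),
        rho 0 = c0 & rho' 0 = c1].

Definition rho12 {R : realType} (rho0 rho1 : R -> R) (t s : R) : R :=
  - rho0 t * rho1 s + rho1 t * rho0 s.

Definition Psi {R : realType} {n : nat} (rho0 rho1 : R -> R)
    (f : 'rV[R]_n -> 'rV[R]_n) (Y0 Y1 : 'rV[R]_n) (Y : R -> 'rV[R]_n) (t : R)
    : 'rV[R]_n :=
  \row_(j < n) (rho0 t * Y0 0 j + rho1 t * Y1 0 j
    - \int[lebesgue_measure]_(s in `[0, t]) (rho12 rho0 rho1 t s * f (Y s) 0 j)).

Definition solution {R : realType} {n : nat} (rho0 rho1 : R -> R)
    (f : 'rV[R]_n -> 'rV[R]_n) (Y0 Y1 : 'rV[R]_n) (T : \bar R)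
    (Y : R -> 'rV[R]_n) : Prop :=
  forall t, Ico T t -> Y t = Psi rho0 rho1 f Y0 Y1 Y t.

(* Functions on [0, T) are represented by total functions, whose values outside
   [0, T) are irrelevant: equality means equality on [0, T). *)
Definition unique_solution_in {R : realType} {n : nat} (rho0 rho1 : R -> R)
    (f : 'rV[R]_n -> 'rV[R]_n) (Y0 Y1 : 'rV[R]_n) (T : \bar R)
    (S : set (R -> 'rV[R]_n)) (Y : R -> 'rV[R]_n) : Prop :=
  [/\ S Y, solution rho0 rho1 f Y0 Y1 T Y &
      forall Z, S Z -> solution rho0 rho1 f Y0 Y1 T Z ->
        forall t, Ico T t -> Z t = Y t].

Definition lifespan_bound {R : realType} (T0 p C D : R) (q : \bar R) : \bar R :=
  if D == 0 then +oo%E else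
  match q with
  | EFin q => (- T0 * ((1 - C / (T0 * D `^ ((p - 1) * q)))
                         `^ (1 / ((p + 1) * q)) - 1))%:E
  | _ => (- T0 * (C / D `^ ((p - 1) / (p + 1)) - 1))%:E
  end.

Definition lifespan_ok {R : realType} (T0 p C D : R) (q : \bar R) (T : R)
    : Prop :=
  (q = +oo%E -> D < C `^ ((p + 1) / (p - 1))) /\
  (T%:E <= lifespan_bound T0 p C D q)%E.

(* Main.v *)
Require Import Defs.
From HB Require Import structures.
From mathcomp Require Import all_boot all_order all_algebra.
From mathcomp Require Import all_classical all_reals all_analysis.
From mathcomp Require Import ess_sup_inf measurable_realfun ring lra.
Import Order.TTheory GRing.Theory Num.Theory.
Import numFieldNormedType.Exports.
Set Implicit Arguments.
Unset Strict Implicit.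
Unset Printing Implicit Defensive.
Local Open Scope classical_set_scope.
Local Open Scope ring_scope.

(** Put [b = - 1 / T0]. The scale function is a power of [1 + b t], and the
    coefficient is [A t = m / (1 + b t) ^ 2] with [m > 0]. Nothing else about
    [A] is used: it is positive, decreasing, and inverse square.

    A continuous solution [Y] of the integral equation is twice differentiable
    (the Wronskian of [rho0], [rho1] is 1) and solves [Y'' + A Y + f (Y) = 0].
    This gives (2). Both nonlinear terms are locally Lipschitz, and on a compact
    interval the integral operator is a contraction for an exponentially weighted
    sup norm. Hence two continuous solutions on the same interval coincide
    ([solution_unique]), which settles every uniqueness claim, (3) included:
    elements of X(T) are continuous. Picard iteration gives a solution on the
    whole half-line when the nonlinear term is globally Lipschitz
    ([lipschitz_solution]); this applies to [f] composed with the radial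
    projection on a ball of radius [K].

    It remains to see that the truncation is not active, which follows from the
    energy [E = |Y'| ^ 2 + A |Y| ^ 2], whose derivative is
    [A' |Y| ^ 2 - 2 f (Y) . Y']. For (1) the truncated nonlinear term is bounded
    by [Phi = c K ^ p], so that [sqrt E] grows at most like [Phi t]. With
    [K = r / sqrt (A T)] and [r] comparable with [D], the solution stays in the
    ball up to the time [T] provided that [D ^ (p - 1) ((1 + b T) ^ (p + 1) - 1)]
    is small ([local_existence]). This is the lifespan bound for [q_* = 1], and
    the bounds for the other exponents imply it, since
    [(X ^ q - 1) ^ (1 / q) >= X - 1] for [X, q >= 1].

    For (4) the truncated term is [g (|y| ^ 2) y] with [g >= 0], hence it has a
    nonnegative potential. The sum of the energy, of the potential and of the
    integral of [- A' |Y| ^ 2] is constant in time, and its initial value is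
    bounded independently of the truncation level ([energy_gauge]). A solution
    thus exists on every bounded interval, these solutions are glued by
    uniqueness, and the same identity without truncation bounds the three terms
    of the norm of X(T) on the half-line ([global_existence]). *)

(** * Derivatives and integrals on a half-open interval *)

(** Continuity of [f] on [I], relatively to [I]. *)
Definition cont_on {R : realType} (I : set R) (f : R -> R) : Prop :=
  forall t, I t -> f s @[s --> within I (nbhs t)] --> f t.

Lemma cont_onE {R : realType} (I : set R) (f : R -> R) :
  cont_on I f <-> {within I, continuous f}.
Proof. by split=> [h|/subspace_continuousP h]; [apply/subspace_continuousP|]. Qed.

Section cont_on_theory.
Context {R : realType}.
Implicit Types (I J : set R) (f g : R -> R) (T : \bar R).

Lemma cont_on_eq I f g : (forall t, I t -> f t = g t) -> cont_on I f ->
  cont_on I g.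
Proof.
move=> fg cf t It; rewrite -fg//; apply: cvg_trans (cf t It).
by apply: fmap_within_eq => s /set_mem Is; rewrite fg.
Qed.

Lemma cont_onS I J f : I `<=` J -> cont_on J f -> cont_on I f.
Proof.
move=> IJ cf t It; apply: cvg_trans (cf t (IJ _ It)).
by apply: cvg_app; exact: within_subset.
Qed.

Lemma cont_on_cst I (c : R) : cont_on I (fun=> c).
Proof. by move=> t It; exact: cvg_cst. Qed.

Lemma cont_on_continuous I f : continuous f -> cont_on I f.
Proof. by move=> cf t It; apply: cvg_within_filter; exact: cf. Qed.

Lemma cont_onD I f g : cont_on I f -> cont_on I g ->
  cont_on I (fun t => f t + g t).
Proof. by move=> cf cg t It; apply: cvgD; [exact: cf|exact: cg]. Qed.

Lemma cont_onN I f : cont_on I f -> cont_on I (fun t => - f t).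
Proof. by move=> cf t It; apply: cvgN; exact: cf. Qed.

Lemma cont_onB I f g : cont_on I f -> cont_on I g ->
  cont_on I (fun t => f t - g t).
Proof. by move=> cf cg; apply: cont_onD => //; exact: cont_onN. Qed.

Lemma cont_onM I f g : cont_on I f -> cont_on I g ->
  cont_on I (fun t => f t * g t).
Proof. by move=> cf cg t It; apply: cvgM; [exact: cf|exact: cg]. Qed.

Lemma cont_on_sum I n (f : 'I_n -> R -> R) : (forall j, cont_on I (f j)) ->
  cont_on I (fun t => \sum_(j < n) f j t).
Proof.
elim: n f => [|n ih] f cf.
  by apply: (cont_on_eq _ (@cont_on_cst I 0)) => t _; rewrite big_ord0.
have h := cont_onD (ih _ (fun j => cf (widen_ord (leqnSn n) j))) (cf ord_max).
by apply: (cont_on_eq _ h) => t _; rewrite big_ord_recr.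
Qed.

Lemma cont_on_comp I f g : continuous g -> cont_on I f ->
  cont_on I (fun t => g (f t)).
Proof. by move=> cg cf t It; apply: continuous_cvg (cf t It); exact: cg. Qed.

(** ** The calculus of [derivative_on] *)

Lemma derivative_on_eq I f1 f2 g1 g2 :
  (forall t, I t -> f1 t = f2 t) -> (forall t, I t -> g1 t = g2 t) ->
  derivative_on I f1 g1 -> derivative_on I f2 g2.
Proof.
move=> f12 g12 df t It; rewrite -g12//; apply: cvg_trans (df t It).
by apply: fmap_within_eq => s /set_mem [Is _]; rewrite !f12.
Qed.

Lemma derivative_onS I J f g : I `<=` J -> derivative_on J f g ->
  derivative_on I f g.
Proof.
move=> IJ df t It; apply: cvg_trans (df t (IJ _ It)).
by apply: cvg_app; apply: within_subset; exact: setSD.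
Qed.

Lemma derivative_on_cvg I f g t : derivative_on I f g -> I t ->
  f s @[s --> within (I `\ t) (nbhs t)] --> f t.
Proof.
move=> df It.
have h : f t + (s - t) * ((f s - f t) / (s - t))
    @[s --> within (I `\ t) (nbhs t)] --> f t + (t - t) * g t.
  apply: cvgD; first exact: cvg_cst.
  apply: cvgM; last exact: df.
  apply: cvgB; last exact: cvg_cst.
  by apply: cvg_within_filter; exact: cvg_id.
rewrite subrr mul0r addr0 in h; apply: cvg_trans h.
apply: fmap_within_eq => s /set_mem [_ /= st].
by rewrite mulrC divfK ?subr_eq0; [rewrite addrC subrK|exact/eqP].
Qed.

Lemma derivative_on_cont I f g : derivative_on I f g -> cont_on I f.
Proof.
move=> df t It; have h := derivative_on_cvg df It.
apply/cvgrPdist_lt => e e0; move/cvgrPdist_lt : h => /(_ e e0).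
rewrite !near_withinE; apply: filterS => s h Is.
have [->|/eqP st] := eqVneq s t; first by rewrite subrr normr0.
exact: h.
Qed.

Lemma derivative_on_cst I (c : R) : derivative_on I (fun=> c) (fun=> 0).
Proof.
move=> t It; under eq_fun do rewrite subrr mul0r.
exact: cvg_cst.
Qed.

Lemma derivative_onD I f g f' g' : derivative_on I f f' ->
  derivative_on I g g' ->
  derivative_on I (fun t => f t + g t) (fun t => f' t + g' t).
Proof.
move=> df dg t It.
under eq_fun do rewrite opprD addrACA mulrDl.
by apply: cvgD; [exact: df|exact: dg].
Qed.

Lemma derivative_onN I f f' : derivative_on I f f' ->
  derivative_on I (fun t => - f t) (fun t => - f' t).
Proof.
move=> df t It; under eq_fun do rewrite -opprD mulNr.
by apply: cvgN; exact: df.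
Qed.

Lemma derivative_onB I f g f' g' : derivative_on I f f' ->
  derivative_on I g g' ->
  derivative_on I (fun t => f t - g t) (fun t => f' t - g' t).
Proof. by move=> df dg; apply: derivative_onD => //; exact: derivative_onN. Qed.

Lemma derivative_onM I f g f' g' : derivative_on I f f' ->
  derivative_on I g g' ->
  derivative_on I (fun t => f t * g t) (fun t => f' t * g t + f t * g' t).
Proof.
move=> df dg t It.
have -> : (fun s => (f s * g s - f t * g t) / (s - t)) =
    (fun s => (f s - f t) / (s - t) * g s + f t * ((g s - g t) / (s - t))).
  by apply/funext => s; ring.
apply: cvgD.
  by apply: cvgM; [exact: df|exact: derivative_on_cvg dg It].
by apply: cvgM; [exact: cvg_cst|exact: dg].
Qed.

Lemma derivative_onZ I (c : R) f f' : derivative_on I f f' ->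
  derivative_on I (fun t => c * f t) (fun t => c * f' t).
Proof.
move=> df.
apply: (derivative_on_eq _ _ (derivative_onM (@derivative_on_cst I c) df)) => //.
by move=> t _; rewrite mul0r add0r.
Qed.

Lemma derivative_on_sum I n (f f' : 'I_n -> R -> R) :
  (forall j, derivative_on I (f j) (f' j)) ->
  derivative_on I (fun t => \sum_(j < n) f j t) (fun t => \sum_(j < n) f' j t).
Proof.
move=> df; elim: n f f' df => [|n ih] f f' df.
  apply: (derivative_on_eq _ _ (@derivative_on_cst I 0)) => t _;
  by rewrite big_ord0.
have h := derivative_onD (ih _ _ (fun j => df (widen_ord (leqnSn n) j)))
                       (df ord_max).
by apply: (derivative_on_eq _ _ h) => t _; rewrite big_ord_recr.
Qed.

(** Chain rule, by Caratheodory's device: the difference quotient of the outer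
    function, completed by its derivative at the base point, is continuous. *)
Lemma derivative_on_comp I J f f' g g' : (forall t, I t -> J (f t)) ->
  derivative_on I f f' -> derivative_on J g g' ->
  derivative_on I (fun t => g (f t)) (fun t => g' (f t) * f' t).
Proof.
move=> IJ df dg t It.
pose q v := if v == f t then g' (f t) else (g v - g (f t)) / (v - f t).
have -> : (fun s => (g (f s) - g (f t)) / (s - t)) =
    (fun s => q (f s) * ((f s - f t) / (s - t))).
  apply/funext => s; rewrite /q; case: eqVneq => [->|fst].
    by rewrite !subrr !mul0r mulr0.
  by rewrite mulrACA -mulrA mulVKf// subr_eq0.
apply: cvgM; last exact: df.
have qJ : q v @[v --> within J (nbhs (f t))] --> g' (f t).
  apply/cvgrPdist_lt => e e0.
  have /cvgrPdist_lt/(_ e e0) := dg _ (IJ _ It).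
  rewrite !near_withinE; apply: filterS => v h Jv; rewrite /q.
  case: eqVneq => [_|/eqP vft]; first by rewrite subrr normr0.
  exact: h.
apply: cvg_comp qJ; have fc := derivative_on_cvg df It.
move=> B hB; have h := fc _ hB.
have hI : within (I `\ t) (nbhs t) (I `\ t) by exact: withinT.
by apply: filterS2 hI h => s [Is _] /=; apply; exact: IJ.
Qed.

Lemma is_derive_derivative_on I f g :
  (forall t, I t -> is_derive t 1 f (g t)) -> derivative_on I f g.
Proof.
move=> df t /df [/cvg_ex[l hl]] <-.
have e : 'D_1 f t = l by apply/cvg_lim.
rewrite e => {e}.
move/cvgrPdist_lt : hl => hl.
apply/cvgrPdist_lt => e /hl h; rewrite near_withinE.
have : \forall h \near (0:R), h != 0 ->
    `|l - h^-1 *: ((f \o shift t) (h *: 1) - f t)| < e.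
  exact: h.
move/nbhs_ballP => [d d0 hd]; apply/nbhs_ballP; exists d => // s sd [_ st].
have := hd (s - t); rewrite /= scaler1 subrK subr_eq0 [_ *: _]mulrC; apply.
- by rewrite /ball/= sub0r normrN distrC.
- exact/eqP.
Qed.

Lemma Ioo_near T t : Ioo T t -> \forall s \near t, Ioo T s.
Proof.
move=> [t0 tT]; case: T tT => [T| |]//=; last 1 first.
- move=> _; near=> s; split; last exact: ltry.
  by near: s; exact: lt_nbhsr.
- rewrite lte_fin => tT; near=> s; split; rewrite ?lte_fin; near: s.
  + exact: lt_nbhsr.
  + exact: lt_nbhsl.
Unshelve. all: by end_near. Qed.

Lemma Ioo_Ico T : Ioo T `<=` Ico T.
Proof. by move=> t [/ltW]. Qed.

Lemma derivative_on_interior I f g t : derivative_on I f g ->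
  (\forall s \near t, I s) -> is_derive t 1 f (g t).
Proof.
move=> df tI; have /cvgrPdist_lt h := df t (nbhs_singleton tI).
have H : h^-1 *: ((f \o shift t) (h *: 1) - f t) @[h --> 0^'] --> g t.
  apply/cvgrPdist_lt => e /h; rewrite near_withinE => {}h.
  have /nbhs_ballP[d d0 hd] : \forall s \near t, s <> t ->
      `|g t - (f s - f t) / (s - t)| < e.
    by apply: filterS2 tI h => s Is hs st; exact: hs.
  rewrite /dnbhs near_withinE; apply/nbhs_ballP; exists d => // s sd s0.
  have := hd (s + t); rewrite addrK /= [s *: 1]scaler1 [s^-1 *: _]mulrC; apply.
    by move: sd; rewrite /ball/= sub0r opprD addrCA subrr addr0 normrN.
  by move=> st; move/eqP : s0; apply; lra.
split; first by apply/cvg_ex; exists (g t).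
exact/cvg_lim.
Qed.

Lemma derivative_on_is_derive T f g t : derivative_on (Ico T) f g -> Ioo T t ->
  is_derive t 1 f (g t).
Proof.
move=> df tT; apply: derivative_on_interior df _.
by apply: filterS (Ioo_near tT) => s; exact: Ioo_Ico.
Qed.

Lemma Ico_itv T t : Ico T t -> [set` `[0, t]] `<=` Ico T.
Proof.
move=> [t0 tT] s /=; rewrite in_itv/= => /andP[s0 st]; split=> //.
by apply: le_lt_trans tT; rewrite lee_fin.
Qed.

Lemma Ico_le T s t : Ico T t -> 0 <= s -> s <= t -> Ico T s.
Proof. by move=> tT s0 st; apply: (Ico_itv tT); rewrite /= in_itv/= s0. Qed.

(** A function whose derivative is nonpositive decreases; no assumption on [g]
    is needed at the end points. *)
Lemma derivative_on_le T f g : derivative_on (Ico T) f g ->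
  forall s t : R, 0 <= s -> s <= t -> Ico T t ->
  (forall x : R, s < x -> x < t -> g x <= 0) -> f t <= f s.
Proof.
move=> df s t s0 st tT gle0.
have cf : {within `[s, t], continuous f}.
  apply/cont_onE; apply: (cont_onS _ (derivative_on_cont df)).
  move=> x /=; rewrite in_itv/= => /andP[sx xt].
  by apply: Ico_le tT _ xt; exact: le_trans sx.
have [c] : exists2 c, c \in `[s, t]%R & f t - f s <= 0.
  move: st; rewrite le_eqVlt => /predU1P[<-|st].
    by exists s; rewrite ?subrr// in_itv/= lexx.
  have Ioost x : x \in `]s, t[ -> Ioo T x.
    rewrite in_itv/= => /andP[sx xt]; split; first exact: le_lt_trans sx.
    by apply: lt_trans tT.2; rewrite lte_fin.
  have [c cst fts] :=
    MVT st (fun x xst => derivative_on_is_derive df (Ioost x xst)) cf.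
  exists c; first by apply: subset_itv_oo_cc.
  rewrite fts mulr_le0_ge0//; last by rewrite subr_ge0 ltW.
  by move: cst; rewrite in_itv/= => /andP[? ?]; exact: gle0.
by rewrite subr_le0.
Qed.

Lemma derivative_on_eq0 T f : derivative_on (Ico T) f (fun=> 0) ->
  forall t, Ico T t -> f t = f 0.
Proof.
move=> df t tT; apply/eqP; rewrite eq_le; apply/andP; split.
  by apply: (derivative_on_le df) => //; case: tT.
rewrite -lerN2.
have := derivative_onN df.
move=> /derivative_on_le; apply => //; first by case: tT.
Qed.

(** ** Primitives *)

Lemma cont_on_integrable T f t : cont_on (Ico T) f -> Ico T t ->
  lebesgue_measure.-integrable `[0, t] (EFin \o f).
Proof.
move=> cf tT; apply: continuous_compact_integrable.
  exact: segment_compact.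
by apply/cont_onE; apply: (cont_onS _ cf); exact: Ico_itv.
Qed.

(** If [f] is [e]-close to [c] on [a, b], then so is its mean value there. *)
Lemma Rintegral_increment f (a b c e : R) : 0 <= a -> a <= b ->
  lebesgue_measure.-integrable `[0, b] (EFin \o f) ->
  (forall x, a <= x -> x <= b -> `|f x - c| <= e) ->
  `|\int[lebesgue_measure]_(s in `[0, b]) f s
    - \int[lebesgue_measure]_(s in `[0, a]) f s - c * (b - a)| <= e * (b - a).
Proof.
move=> a0 ab fi fe.
rewrite Rintegral_itvB ?bnd_simp//.
have mm : measurable ([set` `]a, b]] : set (measurableTypeR R)).
  exact: measurable_itv.
have muE : fine (lebesgue_measure [set` `]a, b]]) = b - a.
  rewrite lebesgue_measure_itv/= lte_fin; case: ltgtP ab => // -> _ /=.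
  by rewrite subrr.
have ic x : lebesgue_measure.-integrable `]a, b] (EFin \o (fun=> x)).
  have h : lebesgue_measure.-integrable `[a, b] (EFin \o (fun=> x)).
    apply: continuous_compact_integrable; first exact: segment_compact.
    by apply: continuous_subspaceT => ?; exact: cvg_cst.
  by apply: integrableS h => //; exact: subset_itv_oc_cc.
have fi' : lebesgue_measure.-integrable `]a, b] (EFin \o f).
  by apply: integrableS fi => //; apply: subset_itvr => //; rewrite bnd_simp.
rewrite -{1}muE -Rintegral_cst// -RintegralB//.
have iB : lebesgue_measure.-integrable `]a, b] (EFin \o (fun x => f x - c)).
  by have := integrableB mm fi' (ic c).
apply: (le_trans (le_normr_Rintegral _ _)) => //.
rewrite -{1}muE -Rintegral_cst//; apply: le_Rintegral => //.
  by have := integrable_norm iB.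
move=> x; rewrite /= in_itv/= => /andP[ax xb]; apply: fe => //.
exact: ltW.
Qed.

(** The fundamental theorem of calculus, one-sided at 0. *)
Lemma derivative_on_Rintegral T f : cont_on (Ico T) f ->
  derivative_on (Ico T) (fun t => \int[lebesgue_measure]_(s in `[0, t]) f s) f.
Proof.
move=> cf t tT; apply/cvgrPdist_le => e e0.
have /cvgrPdist_le/(_ e e0) := cf t tT.
rewrite !near_withinE => /nbhs_ballP[d d0 hd].
apply/nbhs_ballP; exists d => // s sd [sT /eqP st].
rewrite distrC.
have near x : (x <= s \/ x <= t) -> (s <= x \/ t <= x) -> Ico T x ->
    `|f x - f t| <= e.
  move=> x1 x2 xT; rewrite distrC; apply: hd => //.
  move: sd; rewrite /ball/= !ltr_norml => /andP[? ?]; apply/andP; split; lra.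
have [s0 _] := sT; have [t0 _] := tT.
have key a b : 0 <= a -> a < b -> Ico T b ->
  (forall x, a <= x -> x <= b -> `|f x - f t| <= e) ->
  `|(\int[lebesgue_measure]_(s in `[0, b]) f s
    - \int[lebesgue_measure]_(s in `[0, a]) f s) / (b - a) - f t| <= e.
  move=> a0 ab bT h.
  have ba : 0 < b - a by rewrite subr_gt0.
  have := Rintegral_increment a0 (ltW ab) (cont_on_integrable cf bT) h.
  set X := (X in `|X - _|) => hX.
  have -> : X / (b - a) - f t = (X - f t * (b - a)) / (b - a).
    by rewrite [RHS]mulrBl mulfK// gt_eqF.
  by rewrite normrM normfV (gtr0_norm ba) ler_pdivrMr.
case: (ltgtP s t) st => // st _.
- rewrite -mulrNN -invrN !opprB; apply: key => // x sx xt.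
  by apply: near; [right|left|apply: Ico_le tT _ xt; exact: le_trans sx].
- apply: key => // x tx xs.
  by apply: near; [left|right|apply: Ico_le sT _ xs; exact: le_trans tx].
Qed.

Lemma Rintegral_derivative_on T f g : derivative_on (Ico T) f g ->
  cont_on (Ico T) g -> forall t, Ico T t ->
  \int[lebesgue_measure]_(s in `[0, t]) g s = f t - f 0.
Proof.
move=> df cg t tT; have dI := derivative_on_Rintegral cg.
have : derivative_on (Ico T) (fun t => f t -
    \int[lebesgue_measure]_(s in `[0, t]) g s) (fun=> 0).
  apply: (derivative_on_eq _ _ (derivative_onB df dI)) => // x _.
  by rewrite subrr.
move/derivative_on_eq0 => /(_ t tT); rewrite set_itv1 Rintegral_set1 subr0.
by move=> <-; rewrite opprB addrC subrK.
Qed.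

Lemma cont_on_bounded T f t : cont_on (Ico T) f -> Ico T t ->
  exists2 M, 0 < M & forall s, 0 <= s -> s <= t -> `|f s| <= M.
Proof.
move=> cf tT.
have cf' : {within `[0, t], continuous f}.
  by apply/cont_onE; apply: (cont_onS _ cf); exact: Ico_itv.
have /compact_bounded[M [_ hM]] :=
  continuous_compact cf' (segment_compact (a:=0) (b:=t)).
exists (`|M| + 1); first by rewrite ltr_wpDl.
move=> s s0 st; apply: (hM (`|M| + 1)); last by exists s => //=; rewrite in_itv/= s0.
by rewrite (le_lt_trans (ler_norm _))// ltrDl.
Qed.

End cont_on_theory.

(** * The Euclidean norm and the nonlinear terms *)

Section enorm_theory.
Context {R : realType}.

Lemma sum_sqr_ge0 n (a : 'I_n -> R) : 0 <= \sum_(j < n) a j ^+ 2.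
Proof. by apply: sumr_ge0 => j _; exact: sqr_ge0. Qed.

(** Cauchy-Schwarz, from Lagrange's identity. *)
Lemma sum_mul_sqr_le n (a b : 'I_n -> R) :
  (\sum_(j < n) a j * b j) ^+ 2
    <= (\sum_(j < n) a j ^+ 2) * (\sum_(j < n) b j ^+ 2).
Proof.
have : 0 <= \sum_(i < n) \sum_(j < n) (a i * b j - a j * b i) ^+ 2.
  by apply: sumr_ge0 => i _; exact: sum_sqr_ge0.
have -> : \sum_(i < n) \sum_(j < n) (a i * b j - a j * b i) ^+ 2 =
  (\sum_(j < n) a j ^+ 2) * (\sum_(j < n) b j ^+ 2) *+ 2
  - (\sum_(j < n) a j * b j) ^+ 2 *+ 2.
  rewrite [X in _ = X *+ 2 - _]mulr_suml [in X in _ = _ - X]expr2.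
  rewrite [X in _ = _ - X *+ 2]mulr_suml.
  have -> : \sum_(i < n) \sum_(j < n) (a i * b j - a j * b i) ^+ 2 =
    \sum_(i < n) \sum_(j < n) (a i ^+ 2 * b j ^+ 2) +
    \sum_(i < n) \sum_(j < n) (a j ^+ 2 * b i ^+ 2) -
    \sum_(i < n) \sum_(j < n) (a i * b i * (a j * b j)) *+ 2.
    rewrite -big_split -sumrB; apply: eq_bigr => i _.
    rewrite -big_split -sumrB; apply: eq_bigr => j _ /=; ring.
  rewrite [X in _ + X - _]exchange_big /= mulr2n; congr (_ + _ - _).
  - by apply: eq_bigr => i _; rewrite mulr_sumr.
  - by apply: eq_bigr => i _; rewrite mulr_sumr.
  - rewrite -sumrMnl; apply: eq_bigr => i _.
    by rewrite sumrMnl mulr_sumr.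
by rewrite subr_ge0 ler_pMn2r.
Qed.

Context {n : nat}.
Implicit Types (y z : 'rV[R]_n).

Lemma enorm_ge0 y : 0 <= enorm y.
Proof. exact: sqrtr_ge0. Qed.

Lemma sqr_enorm y : enorm y ^+ 2 = \sum_(j < n) y 0 j ^+ 2.
Proof. by rewrite sqr_sqrtr// sum_sqr_ge0. Qed.

Lemma enorm_le y (c : R) : 0 <= c ->
  (enorm y <= c) = (\sum_(j < n) y 0 j ^+ 2 <= c ^+ 2).
Proof. by move=> c0; rewrite -sqr_enorm ler_sqr ?nnegrE// enorm_ge0. Qed.

Lemma ler_norm_dot y z :
  `|\sum_(j < n) y 0 j * z 0 j| <= enorm y * enorm z.
Proof.
rewrite -ler_sqr ?nnegrE ?mulr_ge0 ?enorm_ge0//.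
by rewrite exprMn real_normK ?num_real// !sqr_enorm sum_mul_sqr_le.
Qed.

Lemma enormZ (c : R) y : enorm (c *: y) = `|c| * enorm y.
Proof.
rewrite /enorm -sqrtr_sqr -sqrtrM ?sqr_ge0// mulr_sumr; congr Num.sqrt.
by apply: eq_bigr => j _; rewrite mxE exprMn.
Qed.

Lemma enormN y : enorm (- y) = enorm y.
Proof. by rewrite -scaleN1r enormZ normrN1 mul1r. Qed.

Lemma enormB y z : enorm (y - z) = enorm (z - y).
Proof. by rewrite -enormN opprB. Qed.

Lemma enormD y z : enorm (y + z) <= enorm y + enorm z.
Proof.
rewrite enorm_le ?addr_ge0 ?enorm_ge0// sqrrD !sqr_enorm.
have -> : \sum_(j < n) (y + z) 0 j ^+ 2 = \sum_(j < n) y 0 j ^+ 2 +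
    (\sum_(j < n) y 0 j * z 0 j) *+ 2 + \sum_(j < n) z 0 j ^+ 2.
  rewrite -sumrMnl -!big_split; apply: eq_bigr => j _ /=.
  by rewrite mxE sqrrD.
rewrite lerD2r lerD2l ler_pMn2r//.
exact: le_trans (ler_norm _) (ler_norm_dot _ _).
Qed.

Lemma enorm_dist y z : `|enorm y - enorm z| <= enorm (y - z).
Proof.
have h (u v : 'rV[R]_n) : enorm u - enorm v <= enorm (u - v).
  by have := enormD (u - v) v; rewrite subrK lerBlDr.
by rewrite ler_norml h andbT lerNl opprB enormB h.
Qed.

Lemma norm_coord_le y (j : 'I_n) : `|y 0 j| <= enorm y.
Proof.
rewrite -ler_sqr ?nnegrE ?enorm_ge0// real_normK ?num_real// sqr_enorm.
by rewrite (bigD1 j)//= lerDl; apply: sumr_ge0 => i _; exact: sqr_ge0.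
Qed.

Lemma enorm_le_coord y (c : R) : 0 <= c -> (forall j, `|y 0 j| <= c) ->
  enorm y <= Num.sqrt n%:R * c.
Proof.
move=> c0 yc; rewrite enorm_le ?mulr_ge0// exprMn sqr_sqrtr//.
apply: (@le_trans _ _ (\sum_(j < n) c ^+ 2)).
  apply: ler_sum => j _; rewrite -[_ ^+ 2]real_normK ?num_real//.
  by rewrite ler_sqr ?nnegrE.
by rewrite sumr_const card_ord mulr_natl.
Qed.

Lemma enorm_const (c : R) :
  enorm (const_mx c : 'rV[R]_n) = Num.sqrt n%:R * `|c|.
Proof.
rewrite /enorm -sqrtr_sqr -sqrtrM// mulr_natl; congr Num.sqrt.
under eq_bigr do rewrite mxE.
by rewrite sumr_const card_ord.
Qed.

(** ** Lipschitz maps and radial truncation *)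

(** Lipschitz continuity for the Euclidean norm, with constant [L]. *)
Definition lipschitz_enorm (L : R) (f : 'rV[R]_n -> 'rV[R]_n) : Prop :=
  forall y z, enorm (f y - f z) <= L * enorm (y - z).

(** Lipschitz continuity on every Euclidean ball centred at 0. *)
Definition locally_lipschitz (f : 'rV[R]_n -> 'rV[R]_n) : Prop :=
  forall K : R, 0 <= K -> exists2 L : R, 0 <= L &
    forall y z, enorm y <= K -> enorm z <= K ->
      enorm (f y - f z) <= L * enorm (y - z).

(** The factor by which the projection on the ball of radius [K] scales a
    vector of norm [r]. *)
Definition trunc_factor (K r : R) : R := K / Num.max K r.

(** The radial projection on the Euclidean ball of radius [K]. *)
Definition trunc (K : R) y : 'rV[R]_n := trunc_factor K (enorm y) *: y.

Lemma trunc_factor_ge0 (K r : R) : 0 < K -> 0 <= trunc_factor K r.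
Proof. by move=> K0; rewrite divr_ge0 ?le_max ?(ltW K0). Qed.

Lemma trunc_factor_le1 (K r : R) : 0 < K -> trunc_factor K r <= 1.
Proof.
by move=> K0; rewrite ler_pdivrMr ?lt_max ?K0// mul1r le_max lexx.
Qed.

Lemma trunc_factor_mul_le (K r : R) : 0 < K -> trunc_factor K r * r <= K.
Proof.
move=> K0; rewrite mulrAC ler_pdivrMr ?lt_max ?K0//.
by rewrite ler_pM2l// le_max lexx orbT.
Qed.

Lemma enorm_trunc (K : R) y : 0 < K ->
  enorm (trunc K y) = trunc_factor K (enorm y) * enorm y.
Proof. by move=> K0; rewrite enormZ ger0_norm ?trunc_factor_ge0. Qed.

Lemma enorm_trunc_le (K : R) y : 0 < K -> enorm (trunc K y) <= K.
Proof. by move=> K0; rewrite enorm_trunc// trunc_factor_mul_le. Qed.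

Lemma trunc_id (K : R) y : 0 < K -> enorm y <= K -> trunc K y = y.
Proof.
move=> K0 yK; rewrite /trunc /trunc_factor max_l// divff ?scale1r//.
by rewrite gt_eqF.
Qed.

Lemma trunc_lipschitz (K : R) : 0 < K -> lipschitz_enorm 2 (trunc K).
Proof.
move=> K0 y z; set a := trunc_factor K (enorm y).
set b := trunc_factor K (enorm z).
have -> : trunc K y - trunc K z = a *: (y - z) + (a - b) *: z.
  by rewrite scalerBr scalerBl /trunc -/a -/b addrA subrK.
apply: (le_trans (enormD _ _)); rewrite !enormZ mulrDl mul1r; apply: lerD.
  rewrite ger0_norm ?trunc_factor_ge0//.
  by rewrite ler_piMl ?enorm_ge0 ?trunc_factor_le1.
apply: le_trans (enorm_dist _ _).
set M := Num.max K (enorm y); set N := Num.max K (enorm z).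
have M0 : 0 < M by rewrite lt_max K0.
have N0 : 0 < N by rewrite lt_max K0.
have -> : a - b = (K / M) * ((N - M) / N).
  rewrite /a /b /trunc_factor -/M -/N; field.
  by rewrite !gt_eqF.
have NM : `|N - M| <= `|enorm y - enorm z|.
  rewrite distrC /M /N.
  case: (leP K (enorm y)) => Ky; case: (leP K (enorm z)) => Kz //.
  - by rewrite !ger0_norm ?subr_ge0//; lra.
  - by rewrite !ler0_norm ?subr_le0//; lra.
  - by rewrite subrr normr0.
apply: le_trans NM; rewrite normrM [`|(N - M) / N|]normrM (normfV N) (gtr0_norm N0).
set x := `|N - M|.
have -> : `|K / M| * (x / N) * enorm z = (`|K / M| * (enorm z / N)) * x.
  by field; rewrite gt_eqF.
apply: ler_piMl; first exact: normr_ge0.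
rewrite mulr_ile1 ?divr_ge0 ?enorm_ge0 ?(ltW N0)//.
  by rewrite ger0_norm ?trunc_factor_le1 ?trunc_factor_ge0.
by rewrite ler_pdivrMr// mul1r le_max lexx orbT.
Qed.

Lemma locally_lipschitz_trunc (K : R) f : 0 < K -> locally_lipschitz f ->
  exists2 L : R, 0 <= L & lipschitz_enorm L (f \o trunc K).
Proof.
move=> K0 /(_ K (ltW K0))[L L0 hL]; exists (L * 2); first by rewrite mulr_ge0.
move=> y z; apply: (le_trans (hL _ _ _ _)); try exact: enorm_trunc_le.
by rewrite -mulrA ler_wpM2l//; exact: trunc_lipschitz.
Qed.

Lemma lipschitz_locally_lipschitz (L : R) f : 0 <= L -> lipschitz_enorm L f ->
  locally_lipschitz f.
Proof. by move=> L0 hf K _; exists L => // y z _ _; exact: hf. Qed.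

(** ** The power nonlinearities *)

Lemma mul_powR_sub1 (p a : R) : 1 <= p -> 0 <= a -> a `^ (p - 1) * a = a `^ p.
Proof.
move=> p1; rewrite le_eqVlt => /predU1P[<-|a0].
  by rewrite mulr0 powR0// gt_eqF//; lra.
rewrite -{2}(powRr1 (ltW a0)) -powRD ?subrK//.
by rewrite (gt_eqF a0) implybT.
Qed.

Lemma powR_sub_le (p a b K : R) : 1 <= p -> 0 <= b -> b <= a -> a <= K ->
  a `^ p - b `^ p <= p * K `^ (p - 1) * (a - b).
Proof.
move=> p1 b0 ba aK; have p0 : 0 < p by lra.
have a0 : 0 <= a by exact: le_trans ba.
move: b0; rewrite le_eqVlt => /predU1P[<-|b0].
  rewrite powR0 ?gt_eqF// !subr0.
  rewrite -(mul_powR_sub1 p1 a0).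
  rewrite ler_wpM2r//; apply: (@le_trans _ _ (K `^ (p - 1))).
    by rewrite ge0_ler_powR// ?nnegrE ?subr_ge0// (le_trans a0).
  by rewrite ler_peMl// powR_ge0.
have dpow (x : R) : x \in `]b, a[ ->
    is_derive x 1 (fun x : R => x `^ p) (p * x `^ (p - 1)).
  by rewrite in_itv/= => /andP[bx _]; apply: is_derive1_powR; exact: lt_trans bx.
have cpow : {within `[b, a], continuous (fun x : R => x `^ p)}.
  apply: derivable_within_continuous => x; rewrite in_itv/= => /andP[bx _].
  by apply: ex_derive; apply: is_derive1_powR; exact: lt_le_trans bx.
have [c] := MVT_segment ba dpow cpow.
rewrite in_itv/= => /andP[bc ca] ->.
rewrite ler_wpM2r ?subr_ge0// ler_wpM2l ?(ltW p0)//.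
have c0 : 0 < c by exact: lt_le_trans bc.
by rewrite ge0_ler_powR// ?nnegrE ?subr_ge0 ?(ltW c0)//; lra.
Qed.

Lemma dist_powR_le (p a b K : R) : 1 <= p -> 0 <= a -> 0 <= b ->
  a <= K -> b <= K -> `|a `^ p - b `^ p| <= p * K `^ (p - 1) * `|a - b|.
Proof.
move=> p1; wlog ba : a b / b <= a.
  move=> h a0 b0 aK bK; case: (leP b a) => [/h|/ltW /h]; first exact.
  by rewrite distrC [`|b - a|]distrC; exact.
move=> a0 b0 aK bK; rewrite !ger0_norm ?subr_ge0//; first exact: powR_sub_le.
by rewrite ge0_ler_powR ?nnegrE//; lra.
Qed.

Lemma f_abs_locally_lipschitz (lambda p : R) : 1 < p ->
  locally_lipschitz (@f_abs R n lambda p).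
Proof.
move=> p1 K K0.
exists (Num.sqrt n%:R * (`|lambda| * (p * K `^ (p - 1)))).
  by rewrite !mulr_ge0 ?powR_ge0//; lra.
move=> y z yK zK.
have -> : f_abs lambda p y - f_abs lambda p z =
    const_mx (lambda * (enorm y `^ p - enorm z `^ p)).
  by apply/matrixP => i j; rewrite !mxE mulrBr.
rewrite enorm_const normrM -!mulrA; apply: ler_wpM2l => //.
apply: ler_wpM2l => //; rewrite mulrA.
apply: le_trans (dist_powR_le (ltW p1) (enorm_ge0 _) (enorm_ge0 _) yK zK) _.
by rewrite ler_wpM2l ?enorm_dist// mulr_ge0 ?powR_ge0//; lra.
Qed.

Lemma f_gauge_locally_lipschitz (lambda p : R) : 1 < p ->
  locally_lipschitz (@f_gauge R n lambda p).
Proof.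
move=> p1 K K0; set M := p * K `^ (p - 1).
have M0 : 0 <= M by rewrite mulr_ge0 ?powR_ge0//; lra.
exists (`|lambda| * (M + M)); first by rewrite mulr_ge0 ?addr_ge0.
move=> y z; wlog zy : y z / enorm z <= enorm y.
  move=> h yK zK; case: (leP (enorm z) (enorm y)) => [/h|/ltW /h]; first exact.
  by rewrite enormB [enorm (y - z)]enormB; exact.
move=> yK zK; set a := enorm y `^ (p - 1); set b := enorm z `^ (p - 1).
have -> : f_gauge lambda p y - f_gauge lambda p z =
    lambda *: (a *: (y - z) + (a - b) *: z).
  by apply/matrixP => i j; rewrite !mxE -/a -/b; ring.
rewrite enormZ -mulrA ler_wpM2l// mulrDl.
apply: (le_trans (enormD _ _)); rewrite !enormZ.
have ba : b <= a by rewrite ge0_ler_powR ?nnegrE ?enorm_ge0//; lra.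
have aM : a <= M.
  apply: (@le_trans _ _ (K `^ (p - 1))).
    by rewrite ge0_ler_powR ?nnegrE ?enorm_ge0//; lra.
  by rewrite ler_peMl ?powR_ge0// ltW.
apply: lerD; first by rewrite ger0_norm ?powR_ge0// ler_wpM2r ?enorm_ge0.
rewrite ger0_norm ?subr_ge0// mulrBl mul_powR_sub1 ?enorm_ge0 ?(ltW p1)//.
(* [(a - b) |z|] is at most [|y| ^ p - |z| ^ p] as [|z| <= |y|]. *)
apply: (@le_trans _ _ (enorm y `^ p - enorm z `^ p)).
  rewrite lerD2r -(mul_powR_sub1 (ltW p1) (enorm_ge0 y)).
  by rewrite ler_wpM2l ?powR_ge0.
apply: (le_trans (powR_sub_le (ltW p1) (enorm_ge0 _) zy yK)).
rewrite ler_wpM2l//; apply: le_trans (ler_norm _) (enorm_dist _ _).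
Qed.

Lemma enorm_f_abs (lambda p : R) y :
  enorm (f_abs lambda p y) = `|lambda| * Num.sqrt n%:R * enorm y `^ p.
Proof.
rewrite enorm_const normrM (ger0_norm (powR_ge0 _ _)).
by rewrite mulrA [Num.sqrt _ * _]mulrC.
Qed.

Lemma enorm_f_gauge (lambda p : R) y : 1 < p ->
  enorm (f_gauge lambda p y) = `|lambda| * enorm y `^ p.
Proof.
move=> p1; rewrite enormZ normrM (ger0_norm (powR_ge0 _ _)) -mulrA.
by rewrite mul_powR_sub1 ?enorm_ge0 ?ltW.
Qed.

Lemma norm_powR_continuous (r : R) : 0 < r ->
  continuous (fun x : R => `|x| `^ r).
Proof.
move=> r0 x; have [->|x0] := eqVneq x 0; last first.
  have h : {for `|x|, continuous (fun x : R => x `^ r)}.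
    apply: differentiable_continuous; apply/derivable1_diffP.
    by apply: ex_derive; apply: is_derive1_powR; rewrite normr_gt0.
  exact: (cvg_comp _ _ (@norm_continuous _ R x) h).
rewrite /continuous_at normr0 powR0 ?gt_eqF//.
apply/cvgrPdist_lt => e e0; apply/nbhs_ballP.
exists (e `^ r^-1) => /=; first exact: powR_gt0.
move=> y; rewrite /ball/= !sub0r !normrN => ye.
rewrite ger0_norm ?powR_ge0//.
have -> : e = (e `^ r^-1) `^ r by rewrite -powRrM mulVf ?powRr1 ?gt_eqF ?ltW.
by apply: gt0_ltr_powR; rewrite ?nnegrE ?powR_ge0.
Qed.

(** The gauge invariant term at [trunc K y] is a multiple of [y], by a factor
    that is a function of [u = enorm y ^+ 2]. *)
Definition gauge_factor (lambda p K u : R) : R :=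
  lambda * (trunc_factor K (Num.sqrt u) * Num.sqrt u) `^ (p - 1)
    * trunc_factor K (Num.sqrt u).

Lemma f_gauge_trunc (lambda p K : R) y : 0 < K ->
  f_gauge lambda p (trunc K y) = gauge_factor lambda p K (enorm y ^+ 2) *: y.
Proof.
move=> K0; rewrite /f_gauge enorm_trunc// /trunc scalerA /gauge_factor.
by rewrite sqrtr_sqr ger0_norm ?enorm_ge0.
Qed.

Lemma gauge_factor_ge0 (lambda p K u : R) : 0 <= lambda -> 0 < K ->
  0 <= gauge_factor lambda p K u.
Proof.
move=> l0 K0; apply: mulr_ge0; last exact: trunc_factor_ge0.
by apply: mulr_ge0 => //; exact: powR_ge0.
Qed.

Lemma gauge_factor_le (lambda p K u v : R) : 0 <= lambda -> 0 < K -> 1 < p ->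
  0 <= u -> u <= v ->
  gauge_factor lambda p K u <= lambda * Num.sqrt v `^ (p - 1).
Proof.
move=> l0 K0 p1 u0 uv; rewrite /gauge_factor.
apply: (@le_trans _ _ (lambda *
    (trunc_factor K (Num.sqrt u) * Num.sqrt u) `^ (p - 1))).
  by rewrite ler_piMr ?trunc_factor_le1// mulr_ge0 ?powR_ge0.
apply: ler_wpM2l => //.
have h0 := mulr_ge0 (trunc_factor_ge0 (Num.sqrt u) K0) (sqrtr_ge0 u).
have h1 : trunc_factor K (Num.sqrt u) * Num.sqrt u <= Num.sqrt v.
  apply: (@le_trans _ _ (Num.sqrt u)); last exact: ler_wsqrtr.
  by apply: ler_piMl => //; exact: trunc_factor_le1.
by apply: ge0_ler_powR => //; rewrite ?nnegrE//; lra.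
Qed.

Lemma trunc_factor_sqrt_continuous (K : R) : 0 < K ->
  continuous (fun u : R => trunc_factor K (Num.sqrt u)).
Proof.
move=> K0 u; apply: cvgM; first exact: cvg_cst.
apply: cvgV; first by rewrite gt_eqF// lt_max K0.
apply: (@continuous_max _ _ (fun=> K) (@Num.sqrt R)); first exact: cvg_cst.
exact: sqrt_continuous.
Qed.

Lemma gauge_factor_continuous (lambda p K : R) : 1 < p -> 0 < K ->
  continuous (gauge_factor lambda p K).
Proof.
move=> p1 K0 u; have cT := @trunc_factor_sqrt_continuous K K0 u.
apply: cvgM => //; apply: cvgM; first exact: cvg_cst.
have -> : (fun u => (trunc_factor K (Num.sqrt u) * Num.sqrt u) `^ (p - 1)) =
    (fun u => `|trunc_factor K (Num.sqrt u) * Num.sqrt u| `^ (p - 1)).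
  by apply/funext => v; rewrite ger0_norm//;
    exact: mulr_ge0 (trunc_factor_ge0 _ K0) (sqrtr_ge0 v).
have h : {for trunc_factor K (Num.sqrt u) * Num.sqrt u,
    continuous (fun x : R => `|x| `^ (p - 1))}.
  by apply: norm_powR_continuous; lra.
rewrite [X in _ --> X](_ : _ =
  `|trunc_factor K (Num.sqrt u) * Num.sqrt u| `^ (p - 1)); last first.
  rewrite ger0_norm//; exact: mulr_ge0 (trunc_factor_ge0 _ K0) (sqrtr_ge0 u).
have hc : trunc_factor K (Num.sqrt v) * Num.sqrt v @[v --> u]
    --> trunc_factor K (Num.sqrt u) * Num.sqrt u.
  by apply: cvgM => //; exact: sqrt_continuous.
exact: (cvg_comp _ _ hc h).
Qed.

Lemma sqrt_powR_continuous (r : R) : 0 < r ->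
  continuous (fun u : R => Num.sqrt u `^ r).
Proof.
move=> r0 u.
have -> : (fun u : R => Num.sqrt u `^ r) = (fun u => `|Num.sqrt u| `^ r).
  by apply/funext => v; rewrite ger0_norm.
exact: (cvg_comp _ _ (@sqrt_continuous R u) (@norm_powR_continuous r r0 _)).
Qed.

End enorm_theory.

(** What the argument uses of the two nonlinear terms. *)
Lemma power_nonlinearity {R : realType} (n : nat) (lambda p : R)
  (f : 'rV[R]_n -> 'rV[R]_n) : 1 < p ->
  f = f_gauge lambda p \/ f = f_abs lambda p ->
  locally_lipschitz f /\ exists2 la : R, 0 <= la &
    forall y, enorm (f y) <= la * enorm y `^ p.
Proof.
move=> p1 [->|->]; split.
- exact: f_gauge_locally_lipschitz.
- by exists `|lambda| => // y; rewrite enorm_f_gauge.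
- exact: f_abs_locally_lipschitz.
- by exists (`|lambda| * Num.sqrt n%:R); rewrite ?mulr_ge0// => y; rewrite enorm_f_abs.
Qed.

(** * The integral equation *)

(** Componentwise continuity on [0, T) of a vector-valued function. *)
Definition contv {R : realType} {n : nat} (T : \bar R) (Y : R -> 'rV[R]_n)
    : Prop :=
  forall j, cont_on (Ico T) (fun t => Y t 0 j).

(** [e0], [e1] are the solutions of the linear equation with Cauchy data (1, 0)
    and (0, 1), and [d0], [d1] are their derivatives. *)
Record fundamental_system {R : realType} (A e0 d0 e1 d1 : R -> R) : Prop := {
  fs_e0 : derivative_on (Ico +oo) e0 d0 ;
  fs_d0 : derivative_on (Ico +oo) d0 (fun t => - (A t * e0 t)) ;
  fs_e1 : derivative_on (Ico +oo) e1 d1 ;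
  fs_d1 : derivative_on (Ico +oo) d1 (fun t => - (A t * e1 t)) ;
  fs_e00 : e0 0 = 1 ; fs_d00 : d0 0 = 0 ;
  fs_e10 : e1 0 = 0 ; fs_d10 : d1 0 = 1 }.

Section volterra.
Context {R : realType} {n : nat}.
Implicit Types (T : \bar R) (Y Z : R -> 'rV[R]_n) (f : 'rV[R]_n -> 'rV[R]_n).

Lemma Ico_y T : Ico T `<=` (Ico +oo : set R).
Proof. by move=> t [t0 _]; split => //; rewrite ltry. Qed.

Lemma locally_lipschitz_contv T f Y : locally_lipschitz f -> contv T Y ->
  contv T (f \o Y).
Proof.
move=> lf cY j t tT; set K := enorm (Y t) + Num.sqrt (n%:R : R).
have K0 : 0 <= K by rewrite addr_ge0 ?enorm_ge0.
have [L L0 hL] := lf K K0.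
apply/cvgrPdist_le => e e0.
set c := Num.sqrt (n%:R : R).
have c0 : 0 <= c by exact: sqrtr_ge0.
pose d := Num.min 1 (e / (L * c + 1)).
have Lc : 0 < L * c + 1 by rewrite ltr_wpDl// mulr_ge0.
have d0 : 0 < d by rewrite lt_min ltr01 divr_gt0.
have hd : \forall s \near within (Ico T) (nbhs t),
    forall i, `|Y t 0 i - Y s 0 i| <= d.
  apply: filter_forall => i.
  by have /cvgrPdist_le/(_ d d0) := cY i t tT.
apply: filterS hd => s hd.
have hs : enorm (Y t - Y s) <= c * d.
  by apply: enorm_le_coord => [|i]; [exact: ltW|rewrite !mxE].
apply: (@le_trans _ _ (enorm (f (Y t) - f (Y s)))).
  by have := norm_coord_le (f (Y t) - f (Y s)) j; rewrite !mxE.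
apply: (le_trans (hL _ _ _ _)).
- by rewrite lerDl.
- rewrite -lerBlDl; apply: le_trans (_ : enorm (Y s - Y t) <= _).
    exact: le_trans (ler_norm _) (enorm_dist _ _).
  rewrite enormB; apply: (le_trans hs); rewrite ler_piMr//.
  by rewrite ge_min lexx.
- apply: (@le_trans _ _ (L * (c * d))); first exact: ler_wpM2l.
  rewrite mulrA; apply: (@le_trans _ _ ((L * c + 1) * d)).
    by rewrite ler_wpM2r ?lerDl// ltW.
  by rewrite -ler_pdivlMl// mulrC ge_min lexx orbT.
Qed.

Variables (A e0 d0 e1 d1 : R -> R).
Hypothesis fs : fundamental_system A e0 d0 e1 d1.

Let ce0 T : cont_on (Ico T) e0.
Proof. exact: cont_onS (@Ico_y T) (derivative_on_cont (fs_e0 fs)). Qed.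

Let ce1 T : cont_on (Ico T) e1.
Proof. exact: cont_onS (@Ico_y T) (derivative_on_cont (fs_e1 fs)). Qed.

Let de0 T : derivative_on (Ico T) e0 d0.
Proof. exact: derivative_onS (@Ico_y T) (fs_e0 fs). Qed.

Let de1 T : derivative_on (Ico T) e1 d1.
Proof. exact: derivative_onS (@Ico_y T) (fs_e1 fs). Qed.

Let dd0 T : derivative_on (Ico T) d0 (fun t => - (A t * e0 t)).
Proof. exact: derivative_onS (@Ico_y T) (fs_d0 fs). Qed.

Let dd1 T : derivative_on (Ico T) d1 (fun t => - (A t * e1 t)).
Proof. exact: derivative_onS (@Ico_y T) (fs_d1 fs). Qed.

Lemma wronskian T t : Ico T t -> e0 t * d1 t - e1 t * d0 t = 1.
Proof.
move=> tT.
have : derivative_on (Ico T) (fun t => e0 t * d1 t - e1 t * d0 t) (fun=> 0).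
  apply: (derivative_on_eq _ _ (derivative_onB
    (derivative_onM (@de0 T) (@dd1 T)) (derivative_onM (@de1 T) (@dd0 T)))) => //.
  by move=> s _; ring.
move=> /derivative_on_eq0 /(_ t tT) ->.
by rewrite (fs_e00 fs) (fs_e10 fs) (fs_d10 fs) mulr1 mul0r subr0.
Qed.

Local Notation P f Y j t :=
  (\int[lebesgue_measure]_(s in `[0, t]) (e1 s * f (Y s) 0 j)).
Local Notation Q f Y j t :=
  (\int[lebesgue_measure]_(s in `[0, t]) (e0 s * f (Y s) 0 j)).

Variables (Y0 Y1 : 'rV[R]_n).

(** The derivative of [Psi e0 e1 f Y0 Y1 Y]: the terms in which the integrals are
    differentiated cancel. *)
Definition dPsi f Y (t : R) : 'rV[R]_n :=
  \row_j (d0 t * (Y0 0 j + P f Y j t) + d1 t * (Y1 0 j - Q f Y j t)).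

Local Notation Psi := (Psi e0 e1).

Lemma Rintegral_kernel T (phi : R -> R) t : cont_on (Ico T) phi -> Ico T t ->
  \int[lebesgue_measure]_(s in `[0, t]) (rho12 e0 e1 t s * phi s) =
  e1 t * \int[lebesgue_measure]_(s in `[0, t]) (e0 s * phi s)
  - e0 t * \int[lebesgue_measure]_(s in `[0, t]) (e1 s * phi s).
Proof.
move=> cphi tT.
have i0 := cont_on_integrable (cont_onM (@ce0 T) cphi) tT.
have i1 := cont_on_integrable (cont_onM (@ce1 T) cphi) tT.
have c x (h : R -> R) : cont_on (Ico T) h ->
    lebesgue_measure.-integrable `[0, t] (EFin \o (fun s => x * h s)).
  move=> ch; apply: cont_on_integrable tT.
  by apply: cont_onM => //; exact: cont_on_cst.
rewrite -!RintegralZl// -RintegralB//; first last.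
- by apply: c; exact: cont_onM.
- by apply: c; exact: cont_onM.
by apply: eq_Rintegral => s _; rewrite /rho12; ring.
Qed.

Lemma Psi_coord T f Y j t : contv T (f \o Y) -> Ico T t ->
  Psi f Y0 Y1 Y t 0 j =
  e0 t * (Y0 0 j + P f Y j t) + e1 t * (Y1 0 j - Q f Y j t).
Proof. by move=> cY tT; rewrite mxE (Rintegral_kernel (cY j) tT)/=; ring. Qed.

Lemma derivative_on_Psi T f Y j : contv T (f \o Y) ->
  derivative_on (Ico T) (fun t => Psi f Y0 Y1 Y t 0 j)
                        (fun t => dPsi f Y t 0 j).
Proof.
move=> cY.
have dP := derivative_on_Rintegral (cont_onM (@ce1 T) (cY j)).
have dQ := derivative_on_Rintegral (cont_onM (@ce0 T) (cY j)).
have d := derivative_onD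
  (derivative_onM (@de0 T) (derivative_onD (@derivative_on_cst R (Ico T) (Y0 0 j)) dP))
  (derivative_onM (@de1 T) (derivative_onB (@derivative_on_cst R (Ico T) (Y1 0 j)) dQ)).
apply: (derivative_on_eq _ _ d) => t tT /=.
  by rewrite (Psi_coord _ cY tT).
rewrite mxE; ring.
Qed.

(** [Psi e0 e1 f Y0 Y1 Y] solves the linear equation with source [- f (Y t)]. *)
Lemma derivative_on_dPsi T f Y j : contv T (f \o Y) ->
  derivative_on (Ico T) (fun t => dPsi f Y t 0 j)
    (fun t => - (A t * Psi f Y0 Y1 Y t 0 j) - f (Y t) 0 j).
Proof.
move=> cY.
have dP := derivative_on_Rintegral (cont_onM (@ce1 T) (cY j)).
have dQ := derivative_on_Rintegral (cont_onM (@ce0 T) (cY j)).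
have d := derivative_onD
  (derivative_onM (@dd0 T) (derivative_onD (@derivative_on_cst R (Ico T) (Y0 0 j)) dP))
  (derivative_onM (@dd1 T) (derivative_onB (@derivative_on_cst R (Ico T) (Y1 0 j)) dQ)).
apply: (derivative_on_eq _ _ d) => t tT /=; first by rewrite mxE.
rewrite (Psi_coord _ cY tT) -[X in _ - X]mul1r -(wronskian tT).
ring.
Qed.

Lemma contv_Psi T f Y : contv T (f \o Y) -> contv T (Psi f Y0 Y1 Y).
Proof. by move=> cY j; exact: derivative_on_cont (derivative_on_Psi cY). Qed.

Lemma Psi_0 f Y : Psi f Y0 Y1 Y 0 = Y0.
Proof.
apply/rowP => j.
by rewrite mxE set_itv1 Rintegral_set1 (fs_e00 fs) (fs_e10 fs) mul1r mul0r addr0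
  subr0.
Qed.

Lemma dPsi_0 f Y : dPsi f Y 0 = Y1.
Proof.
apply/rowP => j.
by rewrite mxE set_itv1 !Rintegral_set1 (fs_d00 fs) (fs_d10 fs) mul1r mul0r add0r
  subr0.
Qed.

Lemma kernel_bounded t : 0 <= t -> exists2 B : R, 0 < B &
  forall x s : R, 0 <= s -> s <= x -> x <= t -> `|rho12 e0 e1 x s| <= B.
Proof.
move=> t0; have tT : Ico +oo t by split => //; rewrite ltry.
have [B0 B00 h0] := cont_on_bounded (@ce0 _) tT.
have [B1 B10 h1] := cont_on_bounded (@ce1 _) tT.
exists (B0 * B1 + B1 * B0); first by rewrite addr_gt0 ?mulr_gt0.
move=> x s s0 sx xt; apply: (le_trans (ler_normD _ _)).
have x0 : 0 <= x by exact: le_trans sx.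
have st : s <= t by exact: le_trans sx xt.
by rewrite !normrM normrN; apply: lerD; apply: ler_pM => //;
  [apply: h0|apply: h1|apply: h1|apply: h0].
Qed.

Lemma derivative_on_expR (I : set R) (c : R) :
  derivative_on I (fun t => expR (c * t)) (fun t => c * expR (c * t)).
Proof.
have di : derivative_on I (fun t : R => c * t) (fun=> c).
  have h : derivative_on I id (fun=> 1 : R).
    by apply: is_derive_derivative_on => t _; exact: is_derive_id.
  by apply: (derivative_on_eq _ _ (derivative_onZ h)) => // t _; rewrite mulr1.
have de : derivative_on [set: R] expR expR.
  by apply: is_derive_derivative_on => t _; exact: is_derive_expR.
apply: (derivative_on_eq _ _ (derivative_on_comp _ di de)) => // t _.
by rewrite mulrC.
Qed.

(** [Psi] halves the distance measured with the weight [expR (- c * t)], for [c]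
    large enough. *)
Lemma Psi_contraction T f Y Z t (B L c e : R) :
  contv T (f \o Y) -> contv T (f \o Z) -> Ico T t ->
  (forall x s : R, 0 <= s -> s <= x -> x <= t -> `|rho12 e0 e1 x s| <= B) ->
  0 <= B -> 0 <= L -> 0 < c -> 2 * (B * L) <= c -> 0 <= e ->
  (forall (s : R) j, 0 <= s -> s <= t ->
     `|f (Y s) 0 j - f (Z s) 0 j| <= L * (e * expR (c * s))) ->
  forall (s : R) j, 0 <= s -> s <= t ->
    `|Psi f Y0 Y1 Y s 0 j - Psi f Y0 Y1 Z s 0 j| <= e / 2 * expR (c * s).
Proof.
move=> cY cZ tT hB B0 L0 c0 BLc e0' hL s j s0 st.
have sT : Ico T s by exact: Ico_le tT s0 st.
have crho : cont_on (Ico T) (rho12 e0 e1 s).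
  by apply: cont_onD; apply: cont_onM => //; exact: cont_on_cst.
have cint W : contv T (f \o W) -> lebesgue_measure.-integrable `[0, s]
    (EFin \o (fun x => rho12 e0 e1 s x * f (W x) 0 j)).
  by move=> cW; apply: cont_on_integrable sT; apply: cont_onM => //; exact: cW.
have subBB (x y z : R) : x - y - (x - z) = z - y by ring.
rewrite !mxE subBB -RintegralB//; [|exact: cint..].
pose h x := rho12 e0 e1 s x * f (Z x) 0 j - rho12 e0 e1 s x * f (Y x) 0 j.
rewrite -[X in `|X| <= _]/(\int[lebesgue_measure]_(x in `[0, s]) h x).
have ch : cont_on (Ico T) h.
  by apply: cont_onB; apply: cont_onM.
pose g x : R := (B * L * e / c) * expR (c * x).
pose g' x : R := (B * L * e / c) * (c * expR (c * x)).
have dg : derivative_on (Ico T) g g'.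
  by apply: derivative_onZ; exact: derivative_on_expR.
have cg' : cont_on (Ico T) g'.
  apply: cont_onM; first exact: cont_on_cst.
  apply: cont_onM; first exact: cont_on_cst.
  exact: (derivative_on_cont (@derivative_on_expR _ _)).
apply: (le_trans (le_normr_Rintegral _ (cont_on_integrable ch sT))) => //.
have ih : lebesgue_measure.-integrable `[0, s] (EFin \o (fun x => `|h x|)).
  apply: cont_on_integrable sT.
  by apply: cont_on_comp ch; exact: norm_continuous.
apply: (@le_trans _ _ (\int[lebesgue_measure]_(x in `[0, s]) g' x)).
  apply: le_Rintegral => //; first exact: cont_on_integrable cg' sT.
  move=> x; rewrite /= in_itv/= => /andP[x0 xs].
  rewrite /h -mulrBr normrM /g'.
  have -> : B * L * e / c * (c * expR (c * x)) = B * (L * (e * expR (c * x))).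
    by field; rewrite gt_eqF.
  apply: ler_pM => //; first exact: hB.
  by rewrite distrC; apply: hL => //; exact: le_trans st.
rewrite (Rintegral_derivative_on dg cg' sT) /g mulr0 expR0 mulr1.
apply: (@le_trans _ _ (B * L * e / c * expR (c * s))).
  by rewrite lerBlDr lerDl divr_ge0 ?mulr_ge0// ltW.
rewrite ler_wpM2r ?expR_ge0// ler_pdivrMr//.
have := ler_wpM2r e0' BLc; lra.
Qed.

End volterra.

(** * Uniqueness and Picard iteration *)

Section geometric.
Context {R : realType}.

Lemma exists_half_lt (C e : R) : 0 <= C -> 0 < e -> exists k, C / 2 ^+ k < e.
Proof.
move=> C0 e0; exists (Num.bound (C / e)).
rewrite ltr_pdivrMr ?exprn_gt0// mulrC -ltr_pdivrMr//.
apply: (lt_le_trans (archi_boundP _)); first by rewrite divr_ge0// ltW.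
by rewrite -natrX ler_nat ltnW// ltn_expl.
Qed.

Lemma eq_of_half (x y C : R) : 0 <= C -> (forall k, `|x - y| <= C / 2 ^+ k) ->
  x = y.
Proof.
move=> C0 h; apply/eqP; rewrite -subr_eq0 -normr_le0 leNgt; apply/negP => xy.
have [k] := exists_half_lt C0 xy.
by rewrite ltNge h.
Qed.

(** The limit is the supremum of the lower bounds [u k - 2 C / 2 ^ k]. *)
Lemma geometric_limit (u : nat -> R) (C : R) : 0 <= C ->
  (forall k, `|u k.+1 - u k| <= C / 2 ^+ k) ->
  exists l, forall k, `|u k - l| <= 2 * C / 2 ^+ k.
Proof.
move=> C0 hu.
pose a k := u k - 2 * C / 2 ^+ k; pose b k := u k + 2 * C / 2 ^+ k.
have half k : 2 * C / 2 ^+ k.+1 = C / 2 ^+ k.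
  by rewrite exprS; field; rewrite gt_eqF// exprn_gt0.
have half2 k : 2 * C / 2 ^+ k = C / 2 ^+ k + C / 2 ^+ k by ring.
have aS k : a k <= a k.+1.
  by have := hu k; rewrite ler_norml => /andP[? ?]; rewrite /a half half2; lra.
have bS k : b k.+1 <= b k.
  by have := hu k; rewrite ler_norml => /andP[? ?]; rewrite /b half half2; lra.
have aD k m : a k <= a (k + m)%N.
  by elim: m => [|m ih]; rewrite ?addn0// addnS (le_trans ih).
have bD k m : b (k + m)%N <= b k.
  by elim: m => [|m ih]; rewrite ?addn0// addnS (le_trans _ ih).
have ab k m : a k <= b m.
  apply: le_trans (aD k m) _; apply: le_trans (bD m k); rewrite (addnC m).
  by rewrite /a /b lerD2l ge0_cp// divr_ge0 ?mulr_ge0 ?exprn_ge0.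
exists (sup (range a)) => k; rewrite ler_norml; apply/andP; split.
- suff : sup (range a) <= b k by rewrite /b; lra.
  by apply: ge_sup => [|_ [m _ <-]//]; exists (a 0%N), 0%N.
- suff : a k <= sup (range a) by rewrite /a; lra.
  apply: ub_le_sup; last by exists k.
  by exists (b 0%N) => _ [m _ <-].
Qed.

End geometric.

Section picard.
Context {R : realType} {n : nat}.
Implicit Types (T : \bar R) (Y Z : R -> 'rV[R]_n) (f : 'rV[R]_n -> 'rV[R]_n).
Variables (A e0 d0 e1 d1 : R -> R).
Hypothesis fs : fundamental_system A e0 d0 e1 d1.
Variables (Y0 Y1 : 'rV[R]_n).
Local Notation Psi := (Psi e0 e1).

Lemma contv_bounded T Y t : contv T Y -> Ico T t ->
  exists2 M : R, 0 < M &
    forall s : R, 0 <= s -> s <= t -> forall j, `|Y s 0 j| <= M.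
Proof.
move=> cY tT.
have hM j : exists M : R, 0 < M /\ forall s : R, 0 <= s -> s <= t -> `|Y s 0 j| <= M.
  by have [M ? ?] := cont_on_bounded (cY j) tT; exists M.
have [M {}hM] := choice hM.
exists (1 + \sum_j M j).
  by rewrite ltr_pwDl// sumr_ge0// => j _; exact/ltW/(hM j).1.
move=> s s0 st j; apply: (le_trans ((hM j).2 s s0 st)).
rewrite (bigD1 j)//= addrCA lerDl addr_ge0// sumr_ge0// => i _.
exact/ltW/(hM i).1.
Qed.

Lemma lipschitz_coord f (L e : R) (y z : 'rV[R]_n) : 0 <= L -> 0 <= e ->
  enorm (f y - f z) <= L * enorm (y - z) ->
  (forall j, `|y 0 j - z 0 j| <= e) ->
  forall j, `|f y 0 j - f z 0 j| <= L * Num.sqrt n%:R * e.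
Proof.
move=> L0 e0' hf yz j; apply: (@le_trans _ _ (enorm (f y - f z))).
  by have := norm_coord_le (f y - f z) j; rewrite !mxE.
apply: (le_trans hf); rewrite -mulrA ler_wpM2l//.
by apply: enorm_le_coord => // i; rewrite !mxE.
Qed.

Lemma expR_mul_bound (c s t : R) : 0 < c -> 0 <= s -> s <= t ->
  1 <= expR (c * s) /\ expR (c * s) <= expR (c * t).
Proof.
move=> c0 s0 st; split; first by rewrite -expR0 ler_expR mulr_ge0// ltW.
by rewrite ler_expR ler_pM2l.
Qed.

(** Two continuous solutions of the integral equation coincide. *)
Lemma solution_unique T f Y Z : locally_lipschitz f ->
  contv T Y -> contv T Z ->
  solution e0 e1 f Y0 Y1 T Y -> solution e0 e1 f Y0 Y1 T Z ->
  forall t, Ico T t -> Z t = Y t.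
Proof.
move=> lf cY cZ sY sZ t tT; have t0 := tT.1.
have [M M0 hY] := contv_bounded cY tT.
have [N N0 hZ] := contv_bounded cZ tT.
pose K := Num.sqrt (n%:R : R) * (M + N).
have K0 : 0 <= K by rewrite mulr_ge0// addr_ge0// ltW.
have [L L0 hL] := lf K K0.
have [B B0 hB] := kernel_bounded fs t0.
pose L' := L * Num.sqrt (n%:R : R).
have L'0 : 0 <= L' by rewrite mulr_ge0.
pose c := 2 * (B * L') + 1.
have c0 : 0 < c by rewrite ltr_wpDl// !mulr_ge0// ltW.
(* The difference is a fixed point of the contraction, hence it is halved
   arbitrarily often. *)
have key k : forall (s : R) j, 0 <= s -> s <= t ->
    `|Z s 0 j - Y s 0 j| <= (M + N) / 2 ^+ k * expR (c * s).
  elim: k => [s j s0 st|k ih s j s0 st].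
    rewrite expr0 divr1; apply: (@le_trans _ _ (M + N)).
      rewrite (le_trans (ler_normB _ _))// addrC.
      by apply: lerD; [exact: hY|exact: hZ].
    rewrite ler_peMr ?addr_ge0 ?(ltW M0) ?(ltW N0)//.
    by case: (expR_mul_bound c0 s0 st).
  have sT := Ico_le tT s0 st.
  rewrite (sY s sT) (sZ s sT).
  have -> : (M + N) / 2 ^+ k.+1 = (M + N) / 2 ^+ k / 2.
    by rewrite exprS; field; rewrite gt_eqF// exprn_gt0.
  have e0' : 0 <= (M + N) / 2 ^+ k by rewrite divr_ge0 ?exprn_ge0// addr_ge0// ltW.
  apply: (Psi_contraction fs (f := f) _ _ _ _ tT hB (ltW B0) L'0 c0 _ e0') => //.
  - exact: locally_lipschitz_contv.
  - exact: locally_lipschitz_contv.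
  - by rewrite /c lerDl.
  move=> x i x0 xt; apply: lipschitz_coord => //.
  - by rewrite mulr_ge0 ?expR_ge0.
  - have MN0 : 0 <= M + N by rewrite addr_ge0// ltW.
    apply: hL; apply: enorm_le_coord => // l.
      by apply: (le_trans (hZ x x0 xt l)); rewrite lerDr ltW.
    by apply: (le_trans (hY x x0 xt l)); rewrite lerDl ltW.
  - by move=> l; exact: ih.
apply/rowP => j; apply: (@eq_of_half _ _ _ ((M + N) * expR (c * t))).
  by rewrite mulr_ge0 ?expR_ge0// addr_ge0// ltW.
by move=> k; rewrite mulrAC; exact: key.
Qed.

(** The Picard iteration converges on the whole half-line when the nonlinear
    term is globally Lipschitz. *)
Lemma lipschitz_solution f (L : R) : 0 <= L -> lipschitz_enorm L f ->
  exists Y, contv +oo Y /\ solution e0 e1 f Y0 Y1 +oo Y.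
Proof.
move=> L0 hL; have lf := lipschitz_locally_lipschitz L0 hL.
pose W k := iter k (Psi f Y0 Y1) (fun=> 0).
have cW k : contv +oo (W k).
  elim: k => [|k ih] /=; first by move=> j; exact: cont_on_cst.
  by apply: (contv_Psi fs); exact: locally_lipschitz_contv.
pose L' := L * Num.sqrt (n%:R : R).
have L'0 : 0 <= L' by rewrite mulr_ge0.
have Icoy (t : R) : 0 <= t -> Ico +oo t by move=> t0; split => //; rewrite ltry.
have bW (t : R) : 0 <= t -> exists C : R, 0 <= C /\
    forall s : R, 0 <= s -> s <= t -> forall j k,
      `|W k.+1 s 0 j - W k s 0 j| <= C / 2 ^+ k.
  move=> t0; have tT := Icoy t t0.
  have [M M0 hM] := contv_bounded (cW 1%N) tT.
  have [B B0 hB] := kernel_bounded fs t0.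
  pose c := 2 * (B * L') + 1.
  have c0 : 0 < c by rewrite ltr_wpDl// !mulr_ge0// ltW.
  have key k : forall (s : R) j, 0 <= s -> s <= t ->
      `|W k.+1 s 0 j - W k s 0 j| <= M / 2 ^+ k * expR (c * s).
    elim: k => [s j s0 st|k ih s j s0 st].
      rewrite expr0 divr1 [W 0%N]/W/= [(0 : 'rV_n) _ _]mxE subr0.
      apply: (le_trans (hM s s0 st j)); rewrite ler_peMr ?(ltW M0)//.
      by case: (expR_mul_bound c0 s0 st).
    have -> : M / 2 ^+ k.+1 = M / 2 ^+ k / 2.
      by rewrite exprS; field; rewrite gt_eqF// exprn_gt0.
    have e0' : 0 <= M / 2 ^+ k by rewrite divr_ge0 ?exprn_ge0// ltW.
    rewrite [W k.+2]/W [W k.+1]/W !iterS -/(W k.+1) -/(W k).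
    apply: (Psi_contraction fs (f := f) _ _ _ _ tT hB (ltW B0) L'0 c0 _ e0') => //.
    - exact: (locally_lipschitz_contv lf (cW k.+1)).
    - exact: (locally_lipschitz_contv lf (cW k)).
    - by rewrite /c lerDl.
    move=> x i x0 xt; apply: lipschitz_coord => //.
    - by rewrite mulr_ge0 ?expR_ge0.
    - by move=> l; exact: ih.
  exists (M * expR (c * t)); split; first by rewrite mulr_ge0 ?expR_ge0 ?(ltW M0).
  move=> s s0 st j k; apply: (le_trans (key k s j s0 st)).
  rewrite [leRHS]mulrAC ler_wpM2l ?divr_ge0 ?exprn_ge0 ?(ltW M0)//.
  by case: (expR_mul_bound c0 s0 st).
have lim (t : R) : exists y : 'rV[R]_n, 0 <= t ->
    exists2 C : R, 0 <= C & forall k j, `|W k t 0 j - y 0 j| <= C / 2 ^+ k.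
  have [t0|_] := leP 0 t; last by exists 0.
  have [C [C0 hC]] := bW t t0.
  have /choice[y hy] : forall j, exists l, forall k,
      `|W k t 0 j - l| <= 2 * C / 2 ^+ k.
    by move=> j; apply: geometric_limit => // k; exact: hC.
  exists (\row_j y j) => _; exists (2 * C); first by rewrite mulr_ge0.
  by move=> k j; rewrite mxE.
have [Y hY] := choice lim.
(* The pointwise limits are approached uniformly on [0, t]. *)
have unif (t : R) : 0 <= t -> exists2 C : R, 0 <= C & forall s : R, 0 <= s -> s <= t ->
    forall k j, `|W k s 0 j - Y s 0 j| <= C / 2 ^+ k.
  move=> t0; have [C [C0 hC]] := bW t t0.
  exists (2 * C); first by rewrite mulr_ge0.
  move=> s s0 st k j.
  have [l hl] := geometric_limit C0 (hC s s0 st j).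
  suff -> : Y s 0 j = l by exact: hl.
  have [D D0 hD] := hY s s0.
  apply: (@eq_of_half _ _ _ (D + 2 * C)); first by rewrite addr_ge0// mulr_ge0.
  move=> m; rewrite mulrDl.
  rewrite (le_trans (ler_distD (W m s 0 j) _ _))// lerD//.
  by rewrite distrC.
have cY : contv +oo Y.
  move=> j x [x0 _]; have x10 : 0 <= x + 1 by rewrite addr_ge0.
  have [C C0 hC] := unif _ x10.
  apply/cvgrPdist_lt => e e0'.
  have e30 : 0 < e / 3 by rewrite divr_gt0.
  have [k hk] := exists_half_lt C0 e30.
  have /cvgrPdist_lt/(_ _ e30) := cW k j x (Icoy x x0).
  rewrite !near_withinE => hW.
  have hx1 : \forall s \near x, s <= x + 1.
    have : \forall s \near x, s < x + 1 by apply: lt_nbhsl; rewrite ltrDl.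
    by apply: filterS => s /ltW.
  apply: filterS2 hW hx1 => s hs s1 sI.
  have s0 := sI.1; have {hs} := hs sI.
  have hxk := hC x x0 (ltW (ltr_pwDr ltr01 (lexx x))) k j.
  have hsk := hC s s0 s1 k j.
  move: hxk hsk; rewrite distrC => hxk hsk hs.
  rewrite (le_lt_trans (ler_distD (W k x 0 j) _ _))//.
  have := ler_distD (W k s 0 j) (W k x 0 j) (Y s 0 j).
  lra.
exists Y; split=> // t tT; have t0 := tT.1.
apply/rowP => j.
have [C C0 hC] := unif t t0.
have [B B0 hB] := kernel_bounded fs t0.
pose c := 2 * (B * L') + 1.
have c0 : 0 < c by rewrite ltr_wpDl// !mulr_ge0// ltW.
apply: (@eq_of_half _ _ _ (C + C * expR (c * t))).
  by rewrite addr_ge0// mulr_ge0 ?expR_ge0.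
move=> k; rewrite mulrDl.
rewrite (le_trans (ler_distD (W k.+1 t 0 j) _ _))//; apply: lerD.
  rewrite distrC; apply: (le_trans (hC t t0 (lexx t) k.+1 j)).
  rewrite ler_wpM2l// lef_pV2 ?posrE ?exprn_gt0// exprS.
  by rewrite ler_peMl ?exprn_ge0// ler1n.
have e0' : 0 <= C / 2 ^+ k by rewrite divr_ge0 ?exprn_ge0.
rewrite [W k.+1]/W iterS -/(W k).
apply: (@le_trans _ _ (C / 2 ^+ k / 2 * expR (c * t))).
  apply: (Psi_contraction fs (f := f) _ _ _ _ tT hB (ltW B0) L'0 c0 _ e0') => //.
  - exact: (locally_lipschitz_contv lf (cW k)).
  - exact: (locally_lipschitz_contv lf cY).
  - by rewrite /c lerDl.
  move=> x i x0 xt; apply: lipschitz_coord => //.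
  - by rewrite mulr_ge0 ?expR_ge0.
  - move=> l; apply: le_trans (hC x x0 xt k l) _.
    by rewrite ler_peMr//; case: (expR_mul_bound c0 x0 xt).
rewrite [leRHS]mulrAC ler_wpM2r ?expR_ge0// ler_piMr//.
by lra.
Qed.

End picard.

(** * The coefficient of the equation *)

(** [A t] is [m / (1 + b t) ^ 2] for [t >= 0]; the derivative is two-sided, also
    at [t = 0]. *)
Definition inverse_square {R : realType} (m b : R) (A : R -> R) : Prop :=
  forall t, 0 <= t -> A t = m / (1 + b * t) ^+ 2 /\
    is_derive t 1 A (- (2 * b * m / (1 + b * t) ^+ 3)).

Section coefficient.
Context {R : realType}.

Lemma powR_sub1 (x p : R) : 0 < x -> x `^ (p - 1) = x `^ p / x.
Proof.
move=> x0; rewrite -{3}(powRr1 (ltW x0)) -powRN -powRD//.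
by rewrite (gt_eqF x0) implybT.
Qed.

(** The half-line on which the base of the power in the scale function is
    positive. *)
Definition affine_pos (b : R) : set R := [set t | 0 < 1 + b * t].

Lemma affine_pos_near (b t : R) : affine_pos b t ->
  \forall s \near t, affine_pos b s.
Proof.
move=> h; have c : (1 + b * s) @[s --> t] --> (1 + b * t).
  apply: cvgD; first exact: cvg_cst.
  by apply: cvgM; [exact: cvg_cst|exact: cvg_id].
have /cvgrPdist_lt/(_ _ h) := c; apply: filterS => s.
rewrite /affine_pos/= ltr_norml => /andP[_]; lra.
Qed.

Lemma derivative_on_affine (b : R) I :
  derivative_on I (fun t => 1 + b * t) (fun=> b).
Proof.
have h : derivative_on I id (fun=> 1 : R).
  by apply: is_derive_derivative_on => t _; exact: is_derive_id.
apply: (derivative_on_eq _ _ (derivative_onD (@derivative_on_cst R I 1)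
  (@derivative_onZ R I b _ _ h))) => // t _.
by rewrite add0r mulr1.
Qed.

Lemma derivative_on_affine_inv (b : R) :
  derivative_on (affine_pos b) (fun t => (1 + b * t)^-1)
    (fun t => - (b / (1 + b * t) ^+ 2)).
Proof.
have dV : derivative_on [set x : R | 0 < x] (fun x => x^-1)
    (fun x => - (x ^+ 2)^-1).
  apply: is_derive_derivative_on => x /= x0.
  have x0' : x != 0 by rewrite gt_eqF.
  have := is_deriveV x0' (is_derive_id x 1).
  by move=> h; apply: is_derive_eq; rewrite -[_ *: _]/(_ * _) mulr1.
apply: (derivative_on_eq _ _
  (derivative_on_comp _ (@derivative_on_affine b _) dV)) => // t _.
by rewrite mulNr mulrC.
Qed.

Lemma derivative_on_affine_powR (b p : R) :
  derivative_on (affine_pos b) (fun t => (1 + b * t) `^ p)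
    (fun t => p * b * (1 + b * t) `^ p / (1 + b * t)).
Proof.
have dp : derivative_on [set x : R | 0 < x] (fun x => x `^ p)
    (fun x => p * x `^ (p - 1)).
  by apply: is_derive_derivative_on => x /= x0; exact: is_derive1_powR.
apply: (derivative_on_eq _ _
  (derivative_on_comp _ (@derivative_on_affine b _) dp)) => // t /= t0.
by rewrite powR_sub1//; field; rewrite gt_eqF.
Qed.

Lemma derive1_affine_pos b f g t : derivative_on (affine_pos b) f g ->
  affine_pos b t -> derive1 f t = g t.
Proof.
move=> df tb; rewrite derive1E; apply: derive_val.
by apply: derivative_on_interior df _; exact: affine_pos_near.
Qed.

Variables (n : nat) (a0 a1 sigma : R).
Hypotheses (hn : (1 <= n)%N) (ha0 : 0 < a0) (ha1 : 0 < a1).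
Hypothesis hsigma : - 1 + 2 / n%:R < sigma.

(* With these names the scale function is [a0 (1 + b t) ^ al], and the condition
   on [sigma] says that [0 < al < 1]. *)
Let k := n%:R * (1 + sigma).
Let b := k * a1 / (2 * a0).
Let al := 2 / k.

Let k_gt2 : 2 < k.
Proof.
have n0 : 0 < n%:R :> R by rewrite ltr0n.
rewrite /k mulrC -ltr_pdivrMr//.
by move: hsigma; rewrite addrC ltrBlDr addrC.
Qed.

Let k_gt0 : 0 < k. Proof. by rewrite (lt_trans _ k_gt2). Qed.

Let sigmaN1 : sigma != -1.
Proof.
apply/eqP => s; have := k_gt0; rewrite /k s subrr mulr0 ltxx.
by [].
Qed.

Let b_gt0 : 0 < b.
Proof. by apply: divr_gt0; apply: mulr_gt0. Qed.

Lemma timeT0_neg : - timeT0 n a0 a1 sigma = b^-1.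
Proof. by rewrite /timeT0 opprK /b invf_div -/k. Qed.

Lemma timeT1_infinite : timeT1 n a0 a1 sigma = +oo%E.
Proof.
rewrite /timeT1 ltNge mulr_ge0 ?ltW//.
have n0 : 0 < n%:R :> R by rewrite ltr0n.
by have := k_gt0; rewrite /k pmulr_rgt0.
Qed.

Lemma scaleE t : scale n a0 a1 sigma t = a0 * (1 + b * t) `^ al.
Proof.
rewrite /scale (negbTE sigmaN1) -/k -/al; congr (_ * (1 + _) `^ _).
by rewrite /b mulrAC.
Qed.

Lemma q0E t : affine_pos b t -> q0 n a0 a1 sigma t = 2 * al * b / (1 + b * t).
Proof.
move=> tb; rewrite /q0.
have -> : (fun s => scale n a0 a1 sigma s ^+ 2) =
    (fun s => (a0 * (1 + b * s) `^ al) * (a0 * (1 + b * s) `^ al)).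
  by apply/funext => s; rewrite scaleE.
have ds := @derivative_onZ R _ a0 _ _ (@derivative_on_affine_powR b al).
rewrite (derive1_affine_pos (derivative_onM ds ds) tb) scaleE.
field.
by rewrite !gt_eqF// powR_gt0.
Qed.

Lemma coefAE t : affine_pos b t ->
  coefA n a0 a1 sigma t = al * (1 - al) * b ^+ 2 / (1 + b * t) ^+ 2.
Proof.
move=> tb; rewrite /coefA (q0E tb).
have dq : derivative_on (affine_pos b) (q0 n a0 a1 sigma)
    (fun t => 2 * al * b * - (b / (1 + b * t) ^+ 2)).
  apply: (derivative_on_eq _ _
    (@derivative_onZ R _ (2 * al * b) _ _ (@derivative_on_affine_inv b))) => //.
  by move=> s sb; rewrite q0E.
rewrite (derive1_affine_pos dq tb).
by field; rewrite gt_eqF.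
Qed.

Lemma coefA_inverse_square : exists m c : R,
  [/\ 0 < m, 0 < c, - timeT0 n a0 a1 sigma = c^-1 &
      inverse_square m c (coefA n a0 a1 sigma)].
Proof.
exists (al * (1 - al) * b ^+ 2), b.
split; [|exact: b_gt0|exact: timeT0_neg|].
  have al0 : 0 < al by rewrite divr_gt0.
  have al1 : 0 < 1 - al by rewrite subr_gt0 ltr_pdivrMr// mul1r.
  by apply: mulr_gt0; [exact: mulr_gt0|exact: exprn_gt0].
move=> t t0; set m := al * _ * _.
have tb : affine_pos b t by rewrite /affine_pos/= ltr_pwDl// mulr_ge0// ltW.
split; first exact: coefAE.
have dV := @derivative_on_affine_inv b.
have dA : derivative_on (affine_pos b) (coefA n a0 a1 sigma)
    (fun t => - (2 * b * m / (1 + b * t) ^+ 3)).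
  apply: (derivative_on_eq _ _
    (@derivative_onZ R _ m _ _ (derivative_onM dV dV))) => s sb.
  - by rewrite coefAE// /m; field; rewrite gt_eqF.
  - by field; rewrite gt_eqF.
by apply: derivative_on_interior dA _; exact: affine_pos_near.
Qed.

End coefficient.

Lemma linear_sol_fundamental {R : realType} (A rho0 rho1 : R -> R) :
  linear_sol A +oo 1 0 rho0 -> linear_sol A +oo 0 1 rho1 ->
  exists d0 d1, fundamental_system A rho0 d0 rho1 d1.
Proof.
move=> [d0 [dd0 [h1 h2 h3 h4 h5]]] [d1 [dd1 [g1 g2 g3 g4 g5]]].
exists d0, d1; split=> //.
- by apply: (derivative_on_eq _ _ h2) => // t /h3; lra.
- by apply: (derivative_on_eq _ _ g2) => // t /g3; lra.
Qed.

(** * Energy estimates *)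

Section energy.
Context {R : realType} {n : nat}.
Variables (m b : R) (A e0 d0 e1 d1 : R -> R).
Hypotheses (m_gt0 : 0 < m) (b_gt0 : 0 < b) (hA : inverse_square m b A).
Hypothesis fs : fundamental_system A e0 d0 e1 d1.
Variables (Y0 Y1 : 'rV[R]_n) (f : 'rV[R]_n -> 'rV[R]_n) (T : \bar R).
Variable Y : R -> 'rV[R]_n.
Hypotheses (cfY : contv T (f \o Y)) (sY : solution e0 e1 f Y0 Y1 T Y).

Local Notation V := (dPsi e0 d0 e1 d1 Y0 Y1 f Y).

(** The energy of the linear equation. *)
Definition energy (t : R) : R := enorm (V t) ^+ 2 + A t * enorm (Y t) ^+ 2.

(** The dissipation rate, equal to [- A' |Y| ^ 2]. *)
Definition dissipation (t : R) : R :=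
  2 * b * m / (1 + b * t) ^+ 3 * enorm (Y t) ^+ 2.

Let dot (y z : 'rV[R]_n) : R := \sum_(j < n) y 0 j * z 0 j.

Lemma affine_gt0 (t : R) : 0 <= t -> 0 < 1 + b * t.
Proof. by move=> t0; rewrite ltr_pwDl// mulr_ge0// ltW. Qed.

Lemma coef_gt0 (t : R) : 0 <= t -> 0 < A t.
Proof.
by move=> t0; rewrite (hA t0).1 divr_gt0// exprn_gt0// affine_gt0.
Qed.

Lemma dissipation_ge0 t : 0 <= t -> 0 <= dissipation t.
Proof.
move=> t0; rewrite mulr_ge0 ?sqr_ge0// divr_ge0 ?exprn_ge0//.
  by rewrite !mulr_ge0// ltW.
by rewrite ltW// affine_gt0.
Qed.

Lemma derivative_on_solution j :
  derivative_on (Ico T) (fun t => Y t 0 j) (fun t => V t 0 j).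
Proof.
apply: (derivative_on_eq _ _ (derivative_on_Psi fs cfY)) => // t tT.
by rewrite (sY tT).
Qed.

Lemma contv_velocity : contv T V.
Proof. by move=> j; exact: derivative_on_cont (derivative_on_dPsi fs cfY). Qed.

Let dV j : derivative_on (Ico T) (fun t => V t 0 j)
  (fun t => - (A t * Y t 0 j) - f (Y t) 0 j).
Proof.
apply: (derivative_on_eq _ _ (derivative_on_dPsi fs cfY)) => // t tT.
by rewrite (sY tT).
Qed.

Let dA : derivative_on (Ico T) A (fun t => - (2 * b * m / (1 + b * t) ^+ 3)).
Proof.
by apply: is_derive_derivative_on => t [t0 _]; exact: (hA t0).2.
Qed.

Lemma derivative_on_sqr_enorm (Z Z' : R -> 'rV[R]_n) :
  (forall j, derivative_on (Ico T) (fun t => Z t 0 j) (fun t => Z' t 0 j)) ->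
  derivative_on (Ico T) (fun t => enorm (Z t) ^+ 2)
    (fun t => 2 * \sum_(j < n) Z t 0 j * Z' t 0 j).
Proof.
move=> dZ; have h := derivative_on_sum (fun j => derivative_onM (dZ j) (dZ j)).
apply: (derivative_on_eq _ _ h) => t _.
  by rewrite sqr_enorm; apply: eq_bigr => j _; rewrite expr2.
by rewrite mulr_sumr; apply: eq_bigr => j _; ring.
Qed.

Lemma derivative_on_energy : derivative_on (Ico T) energy
  (fun t => - dissipation t - 2 * dot (V t) (f (Y t))).
Proof.
have dVV : derivative_on (Ico T) (fun t => enorm (V t) ^+ 2)
    (fun t => 2 * \sum_(j < n) V t 0 j *
      (- (A t *: Y t) - f (Y t)) 0 j).
  apply: derivative_on_sqr_enorm => j.
  by apply: (derivative_on_eq _ _ (@dV j)) => // t _; rewrite !mxE.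
have dYY := derivative_on_sqr_enorm derivative_on_solution.
apply: (derivative_on_eq _ _ (derivative_onD dVV (derivative_onM dA dYY))) => //.
move=> t _; rewrite /dissipation mulNr addrC -addrA; congr (_ + _).
rewrite !mulr_sumr -big_split/= -sumrN; apply: eq_bigr => j _.
by rewrite !mxE; ring.
Qed.

Lemma energy_ge (t : R) : Ico T t -> A t * enorm (Y t) ^+ 2 <= energy t /\
  enorm (V t) ^+ 2 <= energy t.
Proof.
move=> [t0 _]; rewrite /energy lerDr sqr_ge0 lerDl; split=> //.
by rewrite mulr_ge0 ?sqr_ge0// ltW// coef_gt0.
Qed.

Lemma energy_ge0 t : Ico T t -> 0 <= energy t.
Proof. by move=> /energy_ge[_]; apply: le_trans; exact: sqr_ge0. Qed.

Lemma energy_0 : Ico T 0 ->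
  energy 0 = enorm Y1 ^+ 2 + A 0 * enorm Y0 ^+ 2.
Proof. by move=> T0; rewrite /energy (sY T0) (dPsi_0 fs) (Psi_0 fs). Qed.

(** With a bounded nonlinear term, the square root of the energy grows at most
    linearly; [e] keeps the square root differentiable. *)
Lemma sqrt_energy_le (Phi e t : R) : (forall y, enorm (f y) <= Phi) -> 0 < e ->
  Ico T t -> Num.sqrt (energy t + e) <= Num.sqrt (energy 0 + e) + Phi * t.
Proof.
move=> hPhi e_gt0 tT; have t0 := tT.1.
have Phi0 : 0 <= Phi := le_trans (enorm_ge0 _) (hPhi 0).
have pos s : Ico T s -> 0 < energy s + e.
  by move=> sT; rewrite ltr_wpDl// energy_ge0.
have dE := derivative_onD derivative_on_energy (@derivative_on_cst R (Ico T) e).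
have dsq : derivative_on [set x : R | 0 < x] Num.sqrt
    (fun x => (2 * Num.sqrt x)^-1).
  by apply: is_derive_derivative_on => x /= x0; exact: is_derive1_sqrt.
have di : derivative_on (Ico T) (fun t => Phi * t) (fun=> Phi).
  have h : derivative_on (Ico T) id (fun=> 1 : R).
    by apply: is_derive_derivative_on => s _; exact: is_derive_id.
  apply: (derivative_on_eq _ _ (@derivative_onZ R _ Phi _ _ h)) => // s _.
  by rewrite mulr1.
have dd := derivative_onB (derivative_on_comp pos dE dsq) di.
have := derivative_on_le dd (lexx 0) t0 tT.
rewrite mulr0 subr0 lerBlDr; apply => s s0 st.
have sT : Ico T s := Ico_le tT (ltW s0) (ltW st).
set r := Num.sqrt _; have r0 : 0 < r by rewrite sqrtr_gt0 pos.
rewrite addr0 subr_le0 mulrC ler_pdivrMr ?mulr_gt0//.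
have Vr : enorm (V s) <= r.
  rewrite -(ger0_norm (enorm_ge0 _)) -sqrtr_sqr; apply: ler_wsqrtr.
  by rewrite ler_wpDr ?(energy_ge sT).2// ltW.
have := ler_norm (- dot (V s) (f (Y s))); rewrite normrN.
have := ler_norm_dot (V s) (f (Y s)); rewrite -/(dot _ _) => h1 h2.
have h3 : enorm (V s) * enorm (f (Y s)) <= r * Phi.
  by apply: ler_pM; rewrite ?enorm_ge0.
have := dissipation_ge0 (ltW s0); lra.
Qed.

Lemma cont_on_dissipation : contv T Y -> cont_on (Ico T) dissipation.
Proof.
move=> cY.
have cA : cont_on (Ico T) (fun t => 1 + b * t).
  exact: derivative_on_cont (@derivative_on_affine R b (Ico T)).
apply: cont_onM.
  move=> t [t0 tT]; apply: cvgM; first exact: cvg_cst.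
  apply: cvgV; first by rewrite gt_eqF// exprn_gt0// affine_gt0.
  have c3 : continuous (fun x : R => x ^+ 3) by move=> x; exact: exprn_continuous.
  by apply: (cont_on_comp c3 cA); split.
apply: (cont_on_eq (f := fun t => \sum_(j < n) Y t 0 j * Y t 0 j)).
  by move=> t _; rewrite sqr_enorm; apply: eq_bigr => j _; rewrite expr2.
by apply: cont_on_sum => j; apply: cont_onM.
Qed.

(** The energy balance for a radial nonlinear term [g (|y| ^ 2) y]: the
    potential is the primitive of [g]. *)
Lemma energy_gauge (g : R -> R) t : (forall y, f y = g (enorm y ^+ 2) *: y) ->
  (forall u, 0 <= u -> 0 <= g u) -> cont_on (Ico +oo) g -> contv T Y ->
  Ico T t ->
  energy t + \int[lebesgue_measure]_(s in `[0, t]) dissipation s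
  <= energy 0 + \int[lebesgue_measure]_(u in `[0, enorm Y0 ^+ 2]) g u.
Proof.
move=> fg g0 cg cY tT.
pose G u := \int[lebesgue_measure]_(v in `[0, u]) g v.
have dG : derivative_on (Ico +oo) G g by exact: derivative_on_Rintegral.
have dYY := derivative_on_sqr_enorm derivative_on_solution.
have pos s : Ico T s -> Ico +oo (enorm (Y s) ^+ 2).
  by move=> _; split; [exact: sqr_ge0|rewrite ltry].
have dD := derivative_on_Rintegral (cont_on_dissipation cY).
have d := derivative_onD (derivative_onD derivative_on_energy dD)
  (derivative_on_comp pos dYY dG).
have d' : derivative_on (Ico T) (fun t => energy t +
    \int[lebesgue_measure]_(s in `[0, t]) dissipation s + G (enorm (Y t) ^+ 2))
    (fun=> 0).
  apply: (derivative_on_eq _ _ d) => // s sT.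
  have -> : dot (V s) (f (Y s)) =
      g (enorm (Y s) ^+ 2) * \sum_(j < n) Y s 0 j * V s 0 j.
    rewrite (fg (Y s)) /dot mulr_sumr; apply: eq_bigr => j _.
    by rewrite [X in _ * X = _]mxE; ring.
  by ring.
have TT0 : Ico T 0 by exact: Ico_le tT _ tT.1.
have := derivative_on_eq0 d' tT; rewrite set_itv1 Rintegral_set1 addr0.
rewrite [Y 0](sY TT0) (Psi_0 fs) -/(G (enorm Y0 ^+ 2)) => <-.
rewrite lerDl; apply: Rintegral_ge0 => u /=; rewrite in_itv/= => /andP[? _].
exact: g0.
Qed.

End energy.

(** * The function spaces *)

Section spaces.
Context {R : realType} {n : nat}.
Implicit Types (T : \bar R) (Y V : R -> 'rV[R]_n).

Lemma Ico_right T t : Ico T t -> exists2 u, t < u & Ico T u.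
Proof.
move=> [t0 tT]; case: T tT => [T| |]//= tT.
- move: tT; rewrite lte_fin => tT; exists ((t + T) / 2); first lra.
  by split; rewrite ?lte_fin; lra.
- by exists (t + 1); [lra|split; [lra|exact: ltry]].
Qed.

Lemma weakly_derivable_contv T Y : weakly_derivable T Y -> contv T Y.
Proof.
move=> [V hV] j.
have cF : cont_on (Ico T)
    (fun t => \int[lebesgue_measure]_(s in `[0, t]) V s 0 j).
  move=> t tT; have [u tu uT] := Ico_right tT.
  have [iV _] := hV j u uT.
  have u0 : 0 <= u := uT.1.
  have /cont_onE/(_ t) := parameterized_integral_continuous u0 iV.
  have tI : [set` `[0, u]] t by rewrite /= in_itv/= tT.1 ltW.
  move=> /(_ tI) h; apply: cvg_trans h.
  apply: cvg_app => B hB.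
  have hu : \forall s \near t, s < u by exact: lt_nbhsl.
  suff : nbhs t (fun s => Ico T s -> B s) by [].
  have {}hB : \forall s \near t, [set` `[0, u]] s -> B s by [].
  apply: filterS2 hB hu => s hs su [s0 _]; apply: hs.
  by rewrite /= in_itv/= s0 ltW.
apply: (cont_on_eq _ (cont_onD (@cont_on_cst R _ (Y 0 0 j)) cF)) => t tT.
by have [_ ->] := hV j t tT.
Qed.

Lemma derivative_on_weakly_derivable T Y V :
  (forall j, derivative_on (Ico T) (fun t => Y t 0 j) (fun t => V t 0 j)) ->
  contv T V -> weakly_derivable T Y.
Proof.
move=> dY cV; exists V => j t tT; split.
  exact: cont_on_integrable (cV j) tT.
by rewrite (Rintegral_derivative_on (dY j) (cV j) tT) addrC subrK.
Qed.

Lemma derivative_on_spaceC1 T Y V :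
  (forall j, derivative_on (Ico T) (fun t => Y t 0 j) (fun t => V t 0 j)) ->
  contv T V -> spaceC1 T Y.
Proof.
move=> dY cV j; exists (fun t => V t 0 j); split; first exact: dY.
by apply/cont_onE; exact: cV.
Qed.

Lemma normL_y_le T (g : R -> R) (M : R) : 0 <= M ->
  (forall t, Ioo T t -> `|g t| <= M) -> (normL +oo T g <= M%:E)%E.
Proof.
move=> M0 gM; rewrite /normL unlock /Lnorm; case: ifPn => // _.
apply/ess_supP; apply: nearW => t /=; rewrite lee_fin patchE.
by case: ifPn => [/set_mem/gM//|_]; rewrite normr0.
Qed.

Lemma normL_2_le T (g : R -> R) (M : R) : 0 <= M ->
  (\int[lebesgue_measure]_(t in Ioo T) (g t ^+ 2)%:E <= M%:E)%E ->
  (normL 2%:E T g <= (Num.sqrt M)%:E)%E.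
Proof.
move=> M0 gM; rewrite /normL unlock /Lnorm.
have -> : (\int[lebesgue_measure]_x
    (`|(EFin \o g \_ (Ioo T)) x| `^ 2))%E
    = (\int[lebesgue_measure]_(t in Ioo T) (g t ^+ 2)%:E)%E.
  rewrite [RHS]integral_mkcond; apply: eq_integral => x _.
  rewrite /= !patchE; case: ifPn => _ /=.
    by rewrite powR_mulrn// real_normK ?num_real.
  by rewrite normr0 powR0// ?pnatr_eq0.
have I0 : (0 <= \int[lebesgue_measure]_(t in Ioo T) (g t ^+ 2)%:E)%E.
  by apply: integral_ge0 => t _; rewrite lee_fin sqr_ge0.
move: gM I0; case: (X in (X <= _)%E -> _) => [x| |]//=.
rewrite !lee_fin => xM x0; rewrite powR12_sqrt//; exact: ler_wsqrtr.
Qed.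

Lemma measurable_Ioo T : measurable (Ioo T).
Proof.
case: T => [T| |].
- have -> : Ioo T%:E = [set` `]0, T[] :> set R.
    apply/seteqP; split=> t /=; rewrite in_itv/=.
      by case=> t0; rewrite lte_fin => tT; rewrite t0.
    by move=> /andP[t0 tT]; split=> //; rewrite lte_fin.
  exact: measurable_itv.
- have -> : Ioo +oo = [set` `]0, +oo[] :> set R.
    apply/seteqP; split=> t /=; rewrite in_itv/= andbT; first by case.
    by move=> t0; split => //; exact: ltry.
  exact: measurable_itv.
- rewrite (_ : Ioo -oo = set0)//.
  by apply/seteqP; split=> t // [].
Qed.

(** On a bounded interval this is monotonicity in the domain, and on the
    half-line it is monotone convergence. *)
Lemma integral_Ioo_le T (h : R -> R) (M : R) : cont_on (Ico +oo) h ->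
  (forall t : R, 0 <= t -> 0 <= h t) -> 0 <= M ->
  (forall t : R, 0 <= t -> (t%:E <= T)%E ->
     \int[lebesgue_measure]_(s in `[0, t]) h s <= M) ->
  (\int[lebesgue_measure]_(t in Ioo T) (h t)%:E <= M%:E)%E.
Proof.
move=> ch h0 M0 hM.
have Icoy (t : R) : 0 <= t -> Ico +oo t by move=> t0; split => //; rewrite ltry.
have ih (t : R) : 0 <= t -> lebesgue_measure.-integrable `[0, t] (EFin \o h).
  by move=> t0; apply: cont_on_integrable ch _; exact: Icoy.
have mh (t : R) : measurable_fun [set` `[0, t]] h.
  have [t0|t0] := leP 0 t.
    by have /integrableP[/measurable_EFinP] := ih t t0.
  by rewrite set_itv_ge ?bnd_simp -?ltNge//; exact: measurable_fun_set0.
have bnd (t : R) : 0 <= t -> (t%:E <= T)%E ->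
    (\int[lebesgue_measure]_(s in `[0%R, t]) (h s)%:E <= M%:E)%E.
  move=> t0 tT; rewrite -[leLHS]fineK ?lee_fin; first exact: hM.
  exact: integrable_fin_num (ih t t0).
have sub (B : set R) : measurable B -> Ioo T `<=` B ->
  measurable_fun B h -> (forall t, B t -> 0 <= t) ->
  (\int[lebesgue_measure]_(t in Ioo T) (h t)%:E <=
   \int[lebesgue_measure]_(t in B) (h t)%:E)%E.
  move=> mB TB mhB B0; apply: ge0_subset_integral => //.
  - exact: measurable_Ioo.
  - exact/measurable_EFinP.
  - by move=> t Bt; rewrite lee_fin h0// B0.
case: T hM bnd sub => [T| |] hM bnd sub.
- have [T0|T0] := leP 0 T; last first.
    rewrite (_ : Ioo T%:E = set0) ?integral_set0 ?lee_fin//.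
    apply/seteqP; split=> t // [t0]; rewrite lte_fin => tT.
    by have := lt_trans t0 (lt_trans tT T0); rewrite ltxx.
  apply: (le_trans (sub [set` `[0, T]] _ _ _ _)) => //.
  + by move=> t [t0]; rewrite lte_fin /= in_itv/= => tT; rewrite !ltW.
  + by move=> t /=; rewrite in_itv/= => /andP[].
  + exact: bnd.
- pose F k : set R := [set` `[0, k%:R]].
  have F0 k t : F k t -> 0 <= t by rewrite /F/= in_itv/= => /andP[].
  have ub : \bigcup_k F k = [set` `[0, +oo[].
    apply/seteqP; split => [t [k _] /F0|t] /=; rewrite in_itv/= andbT// => t0.
    exists (Num.bound t) => //=; rewrite /F/= in_itv/= t0/=.
    by rewrite ltW// archi_boundP.
  have mub : measurable_fun ([set` `[0, +oo[] : set R) h.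
    rewrite -ub; apply/measurable_fun_bigcup => // k.
    + exact: measurable_itv.
    + exact: mh.
  apply: (le_trans (sub [set` `[0, +oo[] _ _ _ _)) => //.
  + by move=> t [t0 _]; rewrite /= in_itv/= andbT ltW.
  + by move=> t /=; rewrite in_itv/= andbT.
  have cvF : (\int[lebesgue_measure]_(x in F k) (h x)%:E @[k --> \oo] -->
      \int[lebesgue_measure]_(x in \bigcup_k F k) (h x)%:E)%E.
    apply: ge0_nondecreasing_set_cvg_integral.
    + apply/nondecreasing_seqP => k; apply/subsetPset => t.
      rewrite /F/= !in_itv/= => /andP[-> tk]/=.
      by rewrite (le_trans tk)// ler_nat.
    + by move=> k; exact: measurable_itv.
    + by move=> k; apply/measurable_EFinP; exact: (mh k%:R).
    + by move=> k t /F0 t0; rewrite lee_fin h0.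
  rewrite -ub; apply: cvge_le cvF.
  by apply: nearW => k; apply: bnd; rewrite ?ler0n// leey.
- rewrite (_ : Ioo -oo = set0) ?integral_set0 ?lee_fin//.
  by apply/seteqP; split=> t // [].
Qed.

Lemma normX_le (m b : R) (A : R -> R) T Y V (M N : R) :
  0 < m -> 0 < b -> inverse_square m b A ->
  (forall j, derivative_on (Ico T) (fun t => Y t 0 j) (fun t => V t 0 j)) ->
  contv +oo Y -> 0 <= M -> 0 <= N ->
  (forall t, Ioo T t -> enorm (V t) <= M) ->
  (forall t, Ioo T t -> A t * enorm (Y t) ^+ 2 <= M ^+ 2) ->
  (forall t : R, 0 <= t -> (t%:E <= T)%E ->
    \int[lebesgue_measure]_(s in `[0, t]) dissipation m b Y s <= N) ->
  (normX A T Y <= (M + M + Num.sqrt N)%:E)%E.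
Proof.
move=> m0 b0 hA dY cY M0 N0 hV hY hN; rewrite /normX !EFinD.
apply: leeD; first apply: leeD.
- apply: normL_y_le => // t tT.
  have -> : Dt Y t = V t.
    apply/rowP => j; rewrite mxE derive1E; apply: derive_val.
    exact: derivative_on_is_derive (dY j) tT.
  by rewrite ger0_norm ?enorm_ge0// hV.
- apply: normL_y_le => // t tT.
  rewrite ger0_norm ?enorm_ge0// enormZ ger0_norm//.
  rewrite -ler_sqr ?nnegrE ?mulr_ge0 ?enorm_ge0// exprMn sqr_sqrtr ?hY//.
  by rewrite ltW// (coef_gt0 m0 b0 hA)// ltW// tT.1.
apply: normL_2_le => //.
have -> : (\int[lebesgue_measure]_(t in Ioo T)
      (enorm (Num.sqrt (- derive1 A t) *: Y t) ^+ 2)%:E)%E =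
    (\int[lebesgue_measure]_(t in Ioo T) (dissipation m b Y t)%:E)%E.
  apply: eq_integral => t /set_mem [t0 _]; congr EFin.
  have [_ /@derive_val] := hA t (ltW t0); rewrite -derive1E => ->.
  rewrite opprK enormZ exprMn ger0_norm// sqr_sqrtr//.
  by rewrite divr_ge0 ?exprn_ge0 ?mulr_ge0 ?ltW// affine_gt0// ltW.
apply: integral_Ioo_le => //.
- exact: (cont_on_dissipation b0 cY).
- by move=> t t0; exact: (dissipation_ge0 m0 b0).
Qed.

End spaces.

(** * Local and global existence *)

Section existence.
Context {R : realType} {n : nat}.
Variables (m b : R) (A e0 d0 e1 d1 : R -> R).
Hypotheses (m_gt0 : 0 < m) (b_gt0 : 0 < b) (hA : inverse_square m b A).
Hypothesis fs : fundamental_system A e0 d0 e1 d1.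
Variables (Y0 Y1 : 'rV[R]_n).
Implicit Types (T : \bar R) (Y Z : R -> 'rV[R]_n) (f : 'rV[R]_n -> 'rV[R]_n).

Lemma unique_solution_intro f T (S : set (R -> 'rV[R]_n)) Y :
  locally_lipschitz f -> (forall Z, S Z -> contv T Z) -> S Y ->
  solution e0 e1 f Y0 Y1 T Y -> unique_solution_in e0 e1 f Y0 Y1 T S Y.
Proof.
move=> lf cS SY sY; split=> // Z SZ sZ.
by apply: (solution_unique fs lf _ _ sY sZ); exact: cS.
Qed.

Lemma contvS T T' Y : (T <= T')%E -> contv T' Y -> contv T Y.
Proof.
move=> TT' cY j; apply: (cont_onS _ (cY j)) => t [t0 tT]; split=> //.
exact: lt_le_trans TT'.
Qed.

(** The integral equation at time [t] only involves the values on [0, t]. *)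
Lemma eq_Psi f g Y Z t : (forall s : R, 0 <= s -> s <= t -> f (Y s) = g (Z s)) ->
  Psi e0 e1 f Y0 Y1 Y t = Psi e0 e1 g Y0 Y1 Z t.
Proof.
move=> fg; apply/rowP => j; rewrite !mxE; congr (_ - _).
apply: eq_Rintegral => s; rewrite inE/= in_itv/= => /andP[s0 st].
by rewrite fg.
Qed.

Lemma coef_decreasing (s t : R) : 0 <= s -> s <= t -> A t <= A s.
Proof.
move=> s0 st; rewrite (hA s0).1 (hA (le_trans s0 st)).1.
have hs := affine_gt0 b_gt0 s0.
have ht := affine_gt0 b_gt0 (le_trans s0 st).
rewrite ler_pM2l// lef_pV2 ?posrE ?exprn_gt0//.
by rewrite ler_sqr ?nnegrE ?(ltW hs) ?(ltW ht)// lerD2l ler_pM2l.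
Qed.

Lemma enorm_le_sqrt_coef Y (t tau E : R) : 0 <= t -> t <= tau ->
  0 <= E -> A t * enorm (Y t) ^+ 2 <= E ->
  enorm (Y t) <= Num.sqrt E / Num.sqrt (A tau).
Proof.
move=> t0 tT E0 h.
have AT := coef_gt0 m_gt0 b_gt0 hA (le_trans t0 tT).
rewrite ler_pdivlMr ?sqrtr_gt0// -ler_sqr ?nnegrE ?mulr_ge0 ?enorm_ge0//.
rewrite exprMn (sqr_sqrtr E0) (sqr_sqrtr (ltW AT)) mulrC; apply: le_trans h.
by rewrite ler_wpM2r ?sqr_ge0// coef_decreasing.
Qed.

(** With the truncated nonlinear term there is a solution on the half-line. *)
Lemma truncated_solution f (K : R) : 0 < K -> locally_lipschitz f ->
  exists Y, [/\ contv +oo Y, contv +oo ((f \o trunc K) \o Y) &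
    solution e0 e1 (f \o trunc K) Y0 Y1 +oo Y].
Proof.
move=> K0 lf; have [L L0 hL] := locally_lipschitz_trunc K0 lf.
have [Y [cY sY]] := lipschitz_solution fs Y0 Y1 L0 hL.
exists Y; split=> //; apply: locally_lipschitz_contv cY.
exact: lipschitz_locally_lipschitz hL.
Qed.

(** As long as the truncation is not active, it may be removed. *)
Lemma solution_trunc f (K : R) T Y : 0 < K ->
  solution e0 e1 (f \o trunc K) Y0 Y1 +oo Y ->
  (forall t, Ico T t -> enorm (Y t) <= K) -> solution e0 e1 f Y0 Y1 T Y.
Proof.
move=> K0 sY hY t tT; rewrite [LHS]sY; last exact: Ico_y tT.
apply: eq_Psi => s s0 st /=; rewrite trunc_id// hY//.
exact: Ico_le tT s0 st.
Qed.

(** Local existence. The smallness condition makes the energy of the truncated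
    problem stay below the threshold at which the truncation is active. *)
Lemma local_existence f (la p r T : R) : locally_lipschitz f ->
  0 <= la -> 0 <= p -> (forall y, enorm (f y) <= la * enorm y `^ p) ->
  0 < r -> 0 < T ->
  4 * (Num.sqrt (A 0) * enorm Y0 + enorm Y1) <= r ->
  T * la * (r / Num.sqrt (A T)) `^ p <= r / 2 ->
  exists2 rho : R, 0 < rho & exists Y,
    unique_solution_in e0 e1 f Y0 Y1 T%:E (ballX A T%:E rho) Y.
Proof.
move=> lf la0 p0 hf r0 T0 hD hT.
have AT : 0 < A T := coef_gt0 m_gt0 b_gt0 hA (ltW T0).
set K := r / Num.sqrt (A T) in hT.
have K0 : 0 < K by rewrite divr_gt0// sqrtr_gt0.
have [Y [cY cfY sY]] := truncated_solution K0 lf.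
have hPhi y : enorm ((f \o trunc K) y) <= la * K `^ p.
  apply: (le_trans (hf _)); rewrite ler_wpM2l// ge0_ler_powR ?nnegrE//.
  - exact: enorm_ge0.
  - exact: ltW.
  - exact: enorm_trunc_le.
have Icoy (t : R) : 0 <= t -> Ico +oo t by move=> t0; split => //; rewrite ltry.
set V := dPsi e0 d0 e1 d1 Y0 Y1 (f \o trunc K) Y.
have E0 := energy_0 fs sY (Icoy 0 (lexx 0)).
set E := energy A e0 d0 e1 d1 Y0 Y1 (f \o trunc K) Y in E0.
pose D := Num.sqrt (A 0) * enorm Y0 + enorm Y1.
have A0 : 0 < A 0 := coef_gt0 m_gt0 b_gt0 hA (lexx 0).
have E0D : E 0 <= (r / 4) ^+ 2.
  have DE : E 0 <= D ^+ 2.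
    rewrite E0 /D sqrrD exprMn (sqr_sqrtr (ltW A0)) addrC lerD2r lerDl.
    by rewrite mulrn_wge0// !mulr_ge0 ?enorm_ge0.
  have D0 : 0 <= D by rewrite addr_ge0 ?mulr_ge0 ?enorm_ge0.
  have Dr : D <= r / 4 by rewrite ler_pdivlMr// mulrC.
  apply: (le_trans DE).
  by rewrite ler_sqr// nnegrE// (le_trans D0).
(* [E 0] and the regularizing constant are both at most [(r / 4) ^ 2], so that
   the initial value of the square root is at most [r / 2]. *)
have Er (t : R) : 0 <= t -> t <= T -> E t <= r ^+ 2.
  move=> t0 tT; have e0' : 0 < (r / 4) ^+ 2 by rewrite exprn_gt0// divr_gt0.
  have h := sqrt_energy_le m_gt0 b_gt0 hA fs cfY sY hPhi e0' (Icoy t t0).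
  rewrite -/E in h.
  have h1 : Num.sqrt (E 0 + (r / 4) ^+ 2) <= r / 2.
    have -> : r / 2 = Num.sqrt ((r / 2) ^+ 2).
      by rewrite sqrtr_sqr ger0_norm//; lra.
    apply: ler_wsqrtr.
    have -> : (r / 2) ^+ 2 = (r / 4) ^+ 2 *+ 4 by field.
    by rewrite -mulr_natr; have := ltW e0'; lra.
  have h2 : la * K `^ p * t <= r / 2.
    apply: le_trans hT; rewrite mulrC mulrA ler_wpM2r ?powR_ge0//.
    by rewrite ler_wpM2r.
  have h3 : Num.sqrt (E t) <= r.
    apply: (@le_trans _ _ (Num.sqrt (E t + (r / 4) ^+ 2))); last lra.
    by apply: ler_wsqrtr; rewrite lerDl sqr_ge0.
  have Et0 : 0 <= E t := energy_ge0 e0 d0 e1 d1 m_gt0 b_gt0 hA Y0 Y1 _ Y (Icoy t t0).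
  by rewrite -[E t](sqr_sqrtr Et0) ler_sqr ?nnegrE// ltW.
have ge (t : R) : Ico +oo t -> A t * enorm (Y t) ^+ 2 <= E t /\
    enorm (V t) ^+ 2 <= E t.
  exact: (energy_ge e0 d0 e1 d1 m_gt0 b_gt0 hA).
have YK t : Ico T%:E t -> enorm (Y t) <= K.
  move=> [t0 tT]; have tT' : t <= T by rewrite ltW// -lte_fin.
  have -> : K = Num.sqrt (r ^+ 2) / Num.sqrt (A T).
    by rewrite sqrtr_sqr ger0_norm// ltW.
  apply: enorm_le_sqrt_coef => //; first exact: sqr_ge0.
  exact: le_trans (ge t (Icoy t t0)).1 (Er t t0 tT').
have sY' := solution_trunc K0 sY YK.
have dY j : derivative_on (Ico T%:E) (fun t => Y t 0 j) (fun t => V t 0 j).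
  have h := derivative_on_solution fs cfY sY.
  exact: (derivative_onS (@Ico_y R T%:E) (h j)).
have cV : contv T%:E V.
  have h := contv_velocity fs (Y0 := Y0) (Y1 := Y1) cfY.
  exact: (contvS (leey _) h).
have cdis : cont_on (Ico +oo) (dissipation m b Y) := cont_on_dissipation b_gt0 cY.
have [B B0 hB] := cont_on_bounded cdis (Icoy T (ltW T0)).
exists (r + r + Num.sqrt (B * T) + 1).
  by rewrite ltr_wpDl// !addr_ge0// ltW.
exists Y; apply: unique_solution_intro => //.
  by move=> Z [wZ _]; exact: weakly_derivable_contv.
split; first exact: derivative_on_weakly_derivable dY cV.
apply: (@le_trans _ _ (r + r + Num.sqrt (B * T))%:E); last by rewrite lee_fin lerDl.
apply: (normX_le m_gt0 b_gt0 hA dY cY) => //; first exact: ltW.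
- by rewrite mulr_ge0// ltW.
- move=> t [t0]; rewrite lte_fin => tT.
  rewrite -ler_sqr ?nnegrE ?enorm_ge0 ?(ltW r0)//.
  exact: le_trans (ge t (Icoy t (ltW t0))).2 (Er t (ltW t0) (ltW tT)).
- move=> t [t0]; rewrite lte_fin => tT.
  exact: le_trans (ge t (Icoy t (ltW t0))).1 (Er t (ltW t0) (ltW tT)).
move=> t t0; rewrite lee_fin => tT.
have h (x : R) : 0 <= x -> x <= t -> `|dissipation m b Y x - 0| <= B.
  by move=> x0 xt; rewrite subr0; apply: hB => //; exact: le_trans tT.
have := Rintegral_increment (lexx 0) t0 (cont_on_integrable cdis (Icoy t t0)) h.
rewrite set_itv1 Rintegral_set1 mul0r !subr0 => hI.
apply: (le_trans (ler_norm _)); apply: (le_trans hI).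
by rewrite ler_wpM2l// ltW.
Qed.

End existence.

Section global.
Context {R : realType} {n : nat}.
Variables (m b : R) (A e0 d0 e1 d1 : R -> R).
Hypotheses (m_gt0 : 0 < m) (b_gt0 : 0 < b) (hA : inverse_square m b A).
Hypothesis fs : fundamental_system A e0 d0 e1 d1.
Variables (Y0 Y1 : 'rV[R]_n).
Implicit Types (T : \bar R) (Y Z : R -> 'rV[R]_n) (f : 'rV[R]_n -> 'rV[R]_n).

Lemma f_gaugeE (lambda p : R) (y : 'rV[R]_n) :
  f_gauge lambda p y = (lambda * Num.sqrt (enorm y ^+ 2) `^ (p - 1)) *: y.
Proof. by rewrite sqrtr_sqr ger0_norm ?enorm_ge0. Qed.

Lemma solutionS f T T' Y : (T <= T')%E ->
  solution e0 e1 f Y0 Y1 T' Y -> solution e0 e1 f Y0 Y1 T Y.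
Proof.
move=> TT' sY t [t0 tT]; apply: sY; split=> //; exact: lt_le_trans TT'.
Qed.

(** For a nonnegative potential the energy bound does not depend on the
    truncation level, so that a level adapted to [0, N) is never reached. *)
Lemma gauge_solution_nat (lambda p : R) (N : nat) : 0 <= lambda -> 1 < p ->
  exists Y, contv +oo Y /\
    solution e0 e1 (f_gauge lambda p) Y0 Y1 (N%:R%:E) Y.
Proof.
move=> l0 p1; set u0 := enorm Y0 ^+ 2.
have u00 : 0 <= u0 by exact: sqr_ge0.
(* A bound on the initial energy and potential that is uniform in the truncation
   level; the summand 1 makes it positive. *)
pose E := enorm Y1 ^+ 2 + A 0 * enorm Y0 ^+ 2
  + lambda * Num.sqrt u0 `^ (p - 1) * u0 + 1.
have A0 : 0 < A 0 := coef_gt0 m_gt0 b_gt0 hA (lexx 0).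
have E0 : 0 < E.
  have h1 : 0 <= A 0 * enorm Y0 ^+ 2 by rewrite mulr_ge0 ?sqr_ge0// ltW.
  have h2 : 0 <= lambda * Num.sqrt u0 `^ (p - 1) * u0.
    by apply: mulr_ge0 => //; apply: mulr_ge0 => //; exact: powR_ge0.
  have := sqr_ge0 (enorm Y1); rewrite /E; lra.
have AN : 0 < A N%:R := coef_gt0 m_gt0 b_gt0 hA (ler0n R N).
pose K := Num.sqrt E / Num.sqrt (A N%:R).
have K0 : 0 < K by rewrite divr_gt0// sqrtr_gt0.
have lf := f_gauge_locally_lipschitz (n := n) lambda p1.
have [Y [cY cfY sY]] := truncated_solution fs Y0 Y1 K0 lf.
exists Y; split=> //; apply: (solution_trunc K0 sY) => t [t0 tN].
have Icoy (s : R) : 0 <= s -> Ico +oo s by move=> ?; split => //; rewrite ltry.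
have cg : continuous (gauge_factor lambda p K) by exact: gauge_factor_continuous.
have g0 u : 0 <= u -> 0 <= gauge_factor lambda p K u.
  by move=> _; exact: gauge_factor_ge0.
have := energy_gauge b_gt0 hA fs cfY sY (fun y => f_gauge_trunc lambda p y K0)
  g0 (cont_on_continuous cg) cY (Icoy t t0).
rewrite (energy_0 fs sY (Icoy 0 (lexx 0))) -/u0 => hE.
apply: (@enorm_le_sqrt_coef R n m b A m_gt0 b_gt0 hA) => //.
- by rewrite ltW// -lte_fin.
- exact: ltW.
apply: le_trans (energy_ge e0 d0 e1 d1 m_gt0 b_gt0 hA Y0 Y1
  (f_gauge lambda p \o trunc K) Y (Icoy t t0)).1 _.
have hI : \int[lebesgue_measure]_(u in `[0, u0]) gauge_factor lambda p K u
    <= lambda * Num.sqrt u0 `^ (p - 1) * u0.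
  have cst x : cont_on (Ico (+oo : \bar R)) (fun=> x : R) by exact: cont_on_cst.
  have id1 := is_derive_derivative_on (I := Ico (+oo : \bar R))
    (fun t _ => is_derive_id t (1 : R)).
  set c := lambda * _.
  have dc : derivative_on (Ico (+oo : \bar R)) (fun t => c * t) (fun=> c).
    apply: (derivative_on_eq _ _ (@derivative_onZ R _ c _ _ id1)) => // s _.
    by rewrite mulr1.
  have := Rintegral_derivative_on dc (cst c) (Icoy u0 u00).
  rewrite mulr0 subr0 => <-; apply: le_Rintegral => //.
  - exact: cont_on_integrable (cont_on_continuous cg) (Icoy u0 u00).
  - exact: cont_on_integrable (cst c) (Icoy u0 u00).
  move=> u; rewrite /= in_itv/= => /andP[u_ge0 uu0].
  exact: gauge_factor_le.
have hW : 0 <= \int[lebesgue_measure]_(s in `[0, t]) dissipation m b Y s.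
  apply: Rintegral_ge0 => s; rewrite /= in_itv/= => /andP[s0 _].
  exact: (dissipation_ge0 m_gt0 b_gt0).
apply: (le_trans (le_trans _ hE)); first by rewrite lerDl.
apply: (@le_trans _ _ (enorm Y1 ^+ 2 + A 0 * enorm Y0 ^+ 2
  + lambda * Num.sqrt u0 `^ (p - 1) * u0)); first by rewrite lerD2l.
by rewrite /E lerDl.
Qed.

(** The solutions on the intervals [0, N) glue, by uniqueness. *)
Lemma gauge_solution_global (lambda p : R) : 0 <= lambda -> 1 < p ->
  exists Y, contv +oo Y /\ solution e0 e1 (f_gauge lambda p) Y0 Y1 +oo Y.
Proof.
move=> l0 p1; have lf := f_gauge_locally_lipschitz (n := n) lambda p1.
have [W hW] := choice (fun N => gauge_solution_nat N l0 p1).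
pose Y t := W (Num.bound t) t.
have YW (N : nat) t : 0 <= t -> t < N%:R -> Y t = W N t.
  move=> t0 tN; set M := Num.bound t.
  have tM : t < M%:R := archi_boundP t0.
  (* [W M] and [W N] solve the same problem on the shorter interval. *)
  pose T := ((minn M N)%:R : R)%:E.
  have TM : (T <= M%:R%:E)%E by rewrite lee_fin ler_nat geq_minl.
  have TN : (T <= N%:R%:E)%E by rewrite lee_fin ler_nat geq_minr.
  suff : W M t = W N t by [].
  apply: (solution_unique fs lf (T := T)) => //.
  - exact: (contvS (leey _) (hW N).1).
  - exact: (contvS (leey _) (hW M).1).
  - exact: (solutionS TN (hW N).2).
  - exact: (solutionS TM (hW M).2).
  - by split=> //; rewrite lte_fin /minn; case: ifP.
exists Y; split.
  move=> j t [t0 _]; set N := Num.bound (t + 1).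
  have t1N : t + 1 < N%:R by apply: archi_boundP; rewrite addr_ge0.
  have tN : t < N%:R by lra.
  have Icoyt : Ico +oo t by split => //; exact: ltry.
  have h := (hW N).1 j t Icoyt; rewrite (YW N t t0 tN).
  apply: cvg_trans h; apply: near_eq_cvg; rewrite near_withinE.
  have hN : \forall s \near t, s < N%:R by exact: lt_nbhsl.
  by apply: filterS hN => s sN [s0 _]; rewrite (YW N s s0 sN).
move=> t [t0 _]; set N := Num.bound t.
have tN : t < N%:R := archi_boundP t0.
have tI : Ico (N%:R%:E) t by split; rewrite ?lte_fin.
rewrite (YW N t t0 tN) ((hW N).2 t tI); apply: eq_Psi => s s0 st.
by rewrite (YW N s s0)//; exact: le_lt_trans tN.
Qed.

(** The energy bounds the three terms of the norm on the half-line. *)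
Lemma global_existence (lambda p : R) : 0 <= lambda -> 1 < p ->
  exists2 rho : R, 0 < rho & exists Y,
    unique_solution_in e0 e1 (f_gauge lambda p) Y0 Y1 +oo (ballX A +oo rho) Y.
Proof.
move=> l0 p1; have lf := f_gauge_locally_lipschitz (n := n) lambda p1.
have [Y [cY sY]] := gauge_solution_global l0 p1.
have cfY := locally_lipschitz_contv lf cY.
set f := f_gauge _ _ in lf sY cfY *.
pose g u := lambda * Num.sqrt u `^ (p - 1).
have cg : continuous g.
  move=> u; apply: cvgM; first exact: cvg_cst.
  by apply: sqrt_powR_continuous; lra.
have g0 u : 0 <= u -> 0 <= g u by move=> _; rewrite mulr_ge0 ?powR_ge0.
have dY := derivative_on_solution fs cfY sY.
have cV := contv_velocity fs (Y0 := Y0) (Y1 := Y1) cfY.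
have hE t (tT : Ico +oo t) := energy_gauge b_gt0 hA fs cfY sY
  (f_gaugeE lambda p) g0 (cont_on_continuous cg) cY tT.
have ge t (tT : Ico +oo t) :=
  energy_ge e0 d0 e1 d1 m_gt0 b_gt0 hA Y0 Y1 f Y tT.
have Icoy (t : R) : 0 <= t -> Ico +oo t by move=> ?; split => //; rewrite ltry.
set E := energy _ _ _ _ _ _ _ _ _ in hE ge.
set M := E 0 + _ in hE.
have M0 : 0 <= M.
  apply: addr_ge0.
    exact: (energy_ge0 e0 d0 e1 d1 m_gt0 b_gt0 hA Y0 Y1 f Y (Icoy 0 (lexx 0))).
  by apply: Rintegral_ge0 => u; rewrite /= in_itv/= => /andP[? _]; exact: g0.
have hW t : 0 <= \int[lebesgue_measure]_(s in `[0, t]) dissipation m b Y s.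
  apply: Rintegral_ge0 => s; rewrite /= in_itv/= => /andP[s0 _].
  exact: (dissipation_ge0 m_gt0 b_gt0).
have EM t : Ico +oo t -> E t <= M.
  by move=> tT; apply: le_trans (hE t tT); rewrite lerDl.
have sqM : M = Num.sqrt M ^+ 2 by rewrite sqr_sqrtr.
exists (Num.sqrt M + Num.sqrt M + Num.sqrt M + 1).
  by rewrite ltr_wpDl// !addr_ge0.
exists Y; apply: (unique_solution_intro fs) => //.
  by move=> Z [wZ _]; exact: weakly_derivable_contv.
split; first exact: derivative_on_weakly_derivable dY cV.
apply: (@le_trans _ _ (Num.sqrt M + Num.sqrt M + Num.sqrt M)%:E); last first.
  by rewrite lee_fin lerDl.
apply: (normX_le m_gt0 b_gt0 hA dY cY) => //.
- move=> t tT; have tT' := Ioo_Ico tT.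
  rewrite -ler_sqr ?nnegrE ?enorm_ge0// -sqM.
  exact: le_trans (ge t tT').2 (EM t tT').
- move=> t tT; have tT' := Ioo_Ico tT; rewrite -sqM.
  exact: le_trans (ge t tT').1 (EM t tT').
move=> t t0 _; apply: le_trans (hE t (Icoy t t0)); rewrite lerDr.
exact: (energy_ge0 e0 d0 e1 d1 m_gt0 b_gt0 hA Y0 Y1 f Y (Icoy t t0)).
Qed.

End global.

(** * The lifespan *)

Section lifespan.
Context {R : realType}.

Lemma ler_powR_inv (q u v : R) : 0 < q -> 0 <= u -> 0 <= v ->
  u `^ q <= v `^ q -> u <= v.
Proof.
move=> q0 u0 v0; apply: contraTT; rewrite -!ltNge => vu.
by apply: gt0_ltr_powR; rewrite ?nnegrE.
Qed.

Lemma powR_ge1 (q x : R) : 0 <= q -> 1 <= x -> 1 <= x `^ q.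
Proof. by move=> q0 x1; have := ler_powR x1 q0; rewrite powRr0. Qed.

(** Superadditivity of [x ^ q]. *)
Lemma powR_sub1_le (q x : R) : 1 <= q -> 1 <= x ->
  (x - 1) `^ q <= x `^ q - 1.
Proof.
move=> q1 x1; have x0 : 0 <= x by lra.
have x10 : 0 <= x - 1 by lra.
have h1 : 1 <= x `^ (q - 1) by apply: powR_ge1 => //; lra.
have h2 : (x - 1) `^ (q - 1) <= x `^ (q - 1).
  by apply: ge0_ler_powR; rewrite ?nnegrE//; lra.
rewrite -(mul_powR_sub1 q1 x10) -(mul_powR_sub1 q1 x0).
have := ler_wpM2r x10 h2; lra.
Qed.

(** Whatever [q] is, a time within the lifespan bound satisfies the smallness
    condition corresponding to [q = 1]: with [X = (1 + b T) ^ (p + 1)], the bound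
    says that [D ^ (p - 1) (X ^ q - 1) ^ (1 / q)] is small, and
    [X - 1 <= (X ^ q - 1) ^ (1 / q)]. *)
Lemma lifespan_ok_le (T0 b p C2 : R) (q : \bar R) : - T0 = b^-1 -> 0 < b ->
  1 < p -> 0 < C2 -> (1 <= q)%E -> exists2 C : R, 0 < C &
  forall D T : R, 0 <= D -> 0 < T -> lifespan_ok T0 p C D q T ->
    D `^ (p - 1) * ((1 + b * T) `^ (p + 1) - 1) <= C2.
Proof.
move=> T0b b0 p1 C20 q1.
have zero T : (0 : R) `^ (p - 1) * ((1 + b * T) `^ (p + 1) - 1) <= C2.
  by rewrite powR0 ?mul0r ?ltW// gt_eqF//; lra.
have T0E : T0 = - b^-1 by rewrite -T0b opprK.
case: q q1 => [q| |//]; rewrite ?lee_fin => q1.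
- have q0 : 0 < q by lra.
  exists (C2 `^ q / b); first by rewrite divr_gt0// powR_gt0.
  move=> D T; rewrite le_eqVlt => /predU1P[<- _ _|D0 T_gt0 [_]]; first exact: zero.
  rewrite /lifespan_bound gt_eqF// lee_fin T0b.
  set d := D `^ ((p - 1) * q).
  have d0 : 0 < d by exact: powR_gt0.
  have -> : 1 - C2 `^ q / b / (T0 * d) = 1 + C2 `^ q / d.
    by rewrite T0E; field; rewrite !gt_eqF.
  rewrite ler_pdivlMl// lerBrDr addrC => hx.
  set x := 1 + b * T in hx *.
  have x1 : 1 <= x by rewrite lerDl mulr_ge0// ltW.
  set X := x `^ (p + 1).
  have X1 : 1 <= X by apply: powR_ge1 => //; lra.
  have hX : X `^ q <= 1 + C2 `^ q / d.
    have pq : 0 < (p + 1) * q by rewrite mulr_gt0//; lra.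
    have Z0 : 0 <= 1 + C2 `^ q / d by rewrite addr_ge0// divr_ge0 ?powR_ge0// ltW.
    rewrite /X -powRrM.
    have -> : 1 + C2 `^ q / d = ((1 + C2 `^ q / d) `^ (1 / ((p + 1) * q)))
        `^ ((p + 1) * q).
      by rewrite -powRrM divfK ?powRr1// gt_eqF.
    by apply: ge0_ler_powR; rewrite ?nnegrE ?powR_ge0//; lra.
  apply: (@ler_powR_inv q) => //; first by rewrite mulr_ge0 ?powR_ge0 ?subr_ge0.
    exact: ltW.
  rewrite powRM ?powR_ge0 ?subr_ge0// -powRrM -/d.
  rewrite mulrC -ler_pdivlMr//; apply: (le_trans (powR_sub1_le q1 X1)).
  by rewrite lerBlDl.
have pp : 0 < p + 1 by lra.
exists (C2 `^ (p + 1)^-1); first exact: powR_gt0.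
move=> D T; rewrite le_eqVlt => /predU1P[<- _ _|D0 T_gt0 [_]]; first exact: zero.
rewrite /lifespan_bound gt_eqF// lee_fin T0b.
set d := D `^ ((p - 1) / (p + 1)).
have d0 : 0 < d by exact: powR_gt0.
rewrite ler_pdivlMl// lerBrDr addrC ler_pdivlMr// => hx.
set x := 1 + b * T in hx *.
have x1 : 1 <= x by rewrite lerDl mulr_ge0// ltW.
have x0 : 0 <= x by lra.
have : (x * d) `^ (p + 1) <= (C2 `^ (p + 1)^-1) `^ (p + 1).
  by apply: ge0_ler_powR; rewrite ?nnegrE ?mulr_ge0 ?powR_ge0 ?(ltW pp) ?(ltW d0).
rewrite powRM ?(ltW d0)// -!powRrM divfK ?gt_eqF// mulVf ?gt_eqF//.
rewrite powRr1 ?(ltW C20)// mulrC; apply: le_trans.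
by rewrite ler_wpM2l ?powR_ge0// gerDl lerN10.
Qed.

(** The bound [r] on the square root of the energy: [4 D], or anything small when
    [D = 0]. *)
Lemma small_radius (p c : R) : 1 < p -> 0 <= c -> exists2 C2 : R, 0 < C2 &
  forall D X : R, 0 <= D -> 0 <= X -> D `^ (p - 1) * X <= C2 ->
    exists r : R, [/\ 0 < r, 4 * D <= r & c * X * r `^ (p - 1) <= 1 / 2].
Proof.
move=> p1 c0; set k := 2 * (c * 4 `^ (p - 1)) + 1.
have k0 : 0 < k by rewrite ltr_wpDl// !mulr_ge0 ?powR_ge0.
exists k^-1; first by rewrite invr_gt0.
move=> D X; rewrite le_eqVlt => /predU1P[<- X0 _|D0 X0 hX].
  have h0 : 0 < 2 * (c * X) + 1 by rewrite ltr_wpDl// !mulr_ge0.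
  exists ((2 * (c * X) + 1)^-1 `^ (p - 1)^-1); split.
  - by rewrite powR_gt0// invr_gt0.
  - by rewrite mulr0 powR_ge0.
  - have pp : 0 < p - 1 by lra.
    rewrite -powRrM mulVf ?(gt_eqF pp)// powRr1 ?invr_ge0 ?(ltW h0)// ler_pdivrMr//.
    have := mulr_ge0 c0 X0; lra.
exists (4 * D); split=> //; first by rewrite mulr_gt0.
rewrite powRM ?(ltW D0)//.
have -> : c * X * (4 `^ (p - 1) * D `^ (p - 1)) =
  c * 4 `^ (p - 1) * (D `^ (p - 1) * X) by ring.
apply: (@le_trans _ _ (c * 4 `^ (p - 1) / k)).
  by apply: ler_wpM2l => //; rewrite mulr_ge0 ?powR_ge0.
by rewrite ler_pdivrMr// /k; lra.
Qed.

(** The smallness condition of the local existence lemma, from the one of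
    [small_radius]: with [x = 1 + b T >= 1] one has
    [b T x ^ p <= x ^ (p + 1) - 1]. *)
Lemma smallness (m b la p T r : R) (A : R -> R) : 0 < m -> 0 < b -> 0 <= la ->
  1 < p -> 0 < T -> 0 < r -> inverse_square m b A ->
  la / (b * Num.sqrt m `^ p) * ((1 + b * T) `^ (p + 1) - 1) * r `^ (p - 1)
    <= 1 / 2 ->
  T * la * (r / Num.sqrt (A T)) `^ p <= r / 2.
Proof.
move=> m0 b0 la0 p1 T0 r0 hA h.
rewrite (hA T (ltW T0)).1; set x := 1 + b * T in h *.
have x1 : 1 <= x by rewrite lerDl mulr_ge0 ?ltW.
have x0 : 0 < x by lra.
have sm : 0 < Num.sqrt m by rewrite sqrtr_gt0.
have -> : Num.sqrt (m / x ^+ 2) = Num.sqrt m / x.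
  by rewrite sqrtrM ?(ltW m0)// sqrtrV ?exprn_ge0 ?(ltW x0)// sqrtr_sqr gtr0_norm.
have -> : r / (Num.sqrt m / x) = r * x * (Num.sqrt m)^-1.
  by field; rewrite !gt_eqF.
rewrite !powRM ?mulr_ge0 ?invr_ge0 ?(ltW r0) ?(ltW x0)//.
have -> : (Num.sqrt m)^-1 `^ p = (Num.sqrt m `^ p)^-1.
  by rewrite -(powR_inv1 (ltW sm)) -powRrM mulN1r powRN.
set M := Num.sqrt m `^ p in h *.
have M0 : 0 < M by exact: powR_gt0.
have key : b * T * x `^ p <= x `^ (p + 1) - 1.
  have xp1 : 1 <= x `^ p by apply: powR_ge1 => //; lra.
  have -> : x `^ (p + 1) = x `^ p * x.
    by rewrite powRD ?powRr1 ?(ltW x0)// (gt_eqF x0) implybT.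
  by rewrite /x; lra.
have rp : r `^ p = r `^ (p - 1) * r by rewrite mul_powR_sub1 ?(ltW p1) ?(ltW r0).
rewrite rp; set S := r `^ (p - 1) in h *.
have S0 : 0 <= S by exact: powR_ge0.
have c0 : 0 <= la / (b * M) by rewrite divr_ge0// mulr_ge0// ltW.
have -> : T * la * (S * r * x `^ p / M) =
    la / (b * M) * (b * T * x `^ p) * S * r.
  by field; rewrite !gt_eqF.
have -> : r / 2 = 1 / 2 * r by field.
rewrite ler_wpM2r ?(ltW r0)//; apply: le_trans h.
by apply: ler_wpM2r => //; apply: ler_wpM2l.
Qed.

End lifespan.

(** * Well-posedness of the Cauchy problem *)

Unset Implicit Arguments.

Theorem theorem1 (R : realType) (n : nat) (a0 a1 sigma lambda p : R)
  (qs : \bar R) (f : 'rV[R]_n -> 'rV[R]_n) (rho0 rho1 : R -> R)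
  (hn : (1 <= n)%N) (ha0 : 0 < a0) (ha1 : 0 < a1)
  (hsigma : - 1 + 2 / n%:R < sigma) (hp : 1 < p)
  (hf : f = f_gauge lambda p \/ f = f_abs lambda p)
  (hqs1 : (1 <= qs)%E) (hqs : ((1 - p / 2)%:E <= qs^-1)%E)
  (hrho0 : linear_sol (coefA n a0 a1 sigma) (timeT1 n a0 a1 sigma) 1 0 rho0)
  (hrho1 : linear_sol (coefA n a0 a1 sigma) (timeT1 n a0 a1 sigma) 0 1 rho1) :
  let A := coefA n a0 a1 sigma in
  let T0 := timeT0 n a0 a1 sigma in
  let T1 := timeT1 n a0 a1 sigma in
  exists2 C : R, 0 < C & forall Y0 Y1 : 'rV[R]_n,
    let D := Num.sqrt (A 0) * enorm Y0 + enorm Y1 in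
    let unique T := unique_solution_in rho0 rho1 f Y0 Y1 T in
    (* (1) *)
    [/\ (exists T r : R, [/\ 0 < T, 0 < r &
           exists Y, unique T%:E (ballX A T%:E r) Y]) /\
        (forall T : R, 0 < T -> lifespan_ok T0 p C D qs T ->
           exists2 r : R, 0 < r & exists Y, unique T%:E (ballX A T%:E r) Y),
    (* (2) *)
        (forall (T : \bar R) (r : R) (Y : R -> 'rV[R]_n), (0 < T)%E -> 0 < r ->
           unique T (ballX A T r) Y -> spaceC1 T Y),
    (* (3) *)
        (forall (T : \bar R) (r : R) (Y : R -> 'rV[R]_n), (0 < T)%E -> 0 < r ->
           unique T (ballX A T r) Y -> unique T (spaceC1 T `&` spaceX A T) Y) &
    (* (4) *)
        (0 <= lambda -> f = f_gauge lambda p ->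
           T1 = +oo%E /\
           exists2 r : R, 0 < r & exists Y,
             unique T1 (ballX A T1 r) Y /\
             forall (T r' : R) (Z : R -> 'rV[R]_n), 0 < T -> 0 < r' ->
               unique T%:E (ballX A T%:E r') Z ->
               forall t, Ico T%:E t -> Z t = Y t)].
Proof.
have T1E := timeT1_infinite a0 hn ha1 hsigma.
have [m [b [m0 b0 T0E hA]]] := coefA_inverse_square hn ha0 ha1 hsigma.
rewrite T1E in hrho0 hrho1 *.
have [d0 [d1 fs]] := linear_sol_fundamental hrho0 hrho1.
have [lf [la la0 hla]] := power_nonlinearity hp hf.
move=> A T0 T1; pose c := la / (b * Num.sqrt m `^ p).
have c0 : 0 <= c by rewrite divr_ge0// mulr_ge0 ?powR_ge0// ltW.
have [C2 C20 hC2] := small_radius hp c0.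
have [C C0 hC] := lifespan_ok_le T0E b0 hp C20 hqs1.
exists C => // Y0 Y1 D unique.
have D0 : 0 <= D by rewrite addr_ge0 ?mulr_ge0 ?enorm_ge0.
have reg T r Y : unique T (ballX A T r) Y -> spaceC1 T Y.
  move=> [[wY _] sY _]; have cY := weakly_derivable_contv wY.
  have cfY := locally_lipschitz_contv lf cY.
  apply: (derivative_on_spaceC1 (V := dPsi rho0 d0 rho1 d1 Y0 Y1 f Y)).
    exact: (derivative_on_solution fs cfY sY).
  exact: (contv_velocity fs (Y0 := Y0) (Y1 := Y1) cfY).
have loc (T r : R) : 0 < T -> 0 < r -> 4 * D <= r ->
    c * ((1 + b * T) `^ (p + 1) - 1) * r `^ (p - 1) <= 1 / 2 ->
    exists2 r : R, 0 < r & exists Y, unique T%:E (ballX A T%:E r) Y.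
  move=> T_gt0 r0 Dr hr.
  apply: (local_existence m0 b0 hA fs lf la0 _ hla r0 T_gt0 Dr); first by lra.
  exact: smallness hA hr.
split.
- split=> [|T T_gt0 hT].
    (* For [T <= 1] the smallness condition is linear in [T], by the bound of
       [powR_sub_le] on the increment of the power, and [k] is its slope. *)
    pose r := 4 * D + 1; have r0 : 0 < r by rewrite ltr_wpDl// mulr_ge0.
    pose k := c * ((p + 1) * (1 + b) `^ (p + 1 - 1) * b) * r `^ (p - 1).
    have k0 : 0 <= k.
      have p10 : 0 <= p + 1 by lra.
      apply: mulr_ge0 (powR_ge0 _ _); apply: mulr_ge0 c0 _.
      apply: mulr_ge0 (ltW b0); exact: mulr_ge0 p10 (powR_ge0 _ _).
    pose T := Num.min 1 (2 * k + 1)^-1.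
    have k1 : 0 < 2 * k + 1 by rewrite ltr_wpDl// mulr_ge0.
    have T_gt0 : 0 < T by rewrite lt_min ltr01 invr_gt0.
    have TT1 : T <= 1 by rewrite ge_min lexx.
    have [r' r'0 hr'] : exists2 r : R, 0 < r &
        exists Y, unique T%:E (ballX A T%:E r) Y.
      apply: (loc T r) => //; first by rewrite lerDl.
      have p11 : 1 <= p + 1 by lra.
      have x1 : 1 <= 1 + b * T by rewrite lerDl mulr_ge0// ltW.
      have xK : 1 + b * T <= 1 + b by rewrite lerD2l ler_piMr// ltW.
      have := powR_sub_le p11 ler01 x1 xK; rewrite powR1 => hx.
      apply: (@le_trans _ _ (k * T)).
        rewrite /k [leRHS]mulrAC; apply: ler_wpM2r; first exact: powR_ge0.
        rewrite -[leRHS]mulrA; apply: ler_wpM2l => //; apply: (le_trans hx).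
        by rewrite le_eqVlt; apply/orP; left; apply/eqP; ring.
      have hT : T <= (2 * k + 1)^-1 by rewrite ge_min lexx orbT.
      apply: (le_trans (ler_wpM2l k0 hT)); rewrite ler_pdivrMr//; lra.
    by exists T, r'.
  have x1 : 1 <= 1 + b * T by rewrite lerDl mulr_ge0// ltW.
  have X0 : 0 <= (1 + b * T) `^ (p + 1) - 1.
    by rewrite subr_ge0; apply: powR_ge1 => //; lra.
  have [r [r0 Dr hr]] := hC2 D _ D0 X0 (hC D T D0 T_gt0 hT).
  exact: loc hr.
- by move=> T r Y _ _; exact: reg.
- move=> T r Y _ _ hY; have [[wY nY] sY _] := hY.
  apply: (unique_solution_intro fs lf) => //.
    by move=> Z [_ [wZ _]]; exact: weakly_derivable_contv.
  split; first exact: reg hY.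
  by split=> //; apply: le_lt_trans nY _; exact: ltry.
- move=> l0 fE; split=> //; subst f.
  have [r r0 [Y hY]] := global_existence m0 b0 hA fs Y0 Y1 l0 hp.
  exists r => //; exists Y; split=> // T r' Z _ _ [[wZ _] sZ _] t tT.
  have [[wY _] sY _] := hY.
  have cY := weakly_derivable_contv wY.
  apply: (solution_unique fs lf (contvS (leey _) cY) _ _ sZ) => //.
    exact: weakly_derivable_contv.
  exact: solutionS (leey _) sY.
Qed.
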